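(* As $X\to\infty$, the number of isomorphism classes of cubic orders whose automorphism group is isomorphic to the cyclic group of order $3$ and whose discriminant is less than $X$ is $$\frac{\pi}{6\sqrt{3}}\,X^{1/2}+O(X^{1/4}).$$
   Context: A cubic ring is a commutative ring with unit that is free of rank $3$ as a $\mathbb{Z}$-module; a cubic order is a cubic ring that is an integral domain (i.e. an order in a cubic field). The discriminant of a cubic ring $R$ with $\mathbb{Z}$-basis $\alpha_1,\alpha_2,\alpha_3$ is $\det(\mathrm{Tr}(\alpha_i\alpha_j))\in\mathbb{Z}$, where $\mathrm{Tr}(z)$ is the trace of multiplication by $z$ on $R$. Objects are counted up to isomorphism. *)

(* Defs.v *)
From HB Require Import structures.
From mathcomp Require Import all_boot all_order all_algebra all_fingroup.
From mathcomp Require Import all_classical all_reals all_analysis.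

Set Implicit Arguments.
Unset Strict Implicit.
Unset Printing Implicit Defensive.

Import Order.TTheory GRing.Theory Num.Theory.
Import numFieldNormedType.Exports.

Local Open Scope classical_set_scope.
Local Open Scope ring_scope.

Definition is_ring_iso (A B : comNzRingType) (f : A -> B) : Prop :=
  [/\ GRing.zmod_morphism f, GRing.monoid_morphism f & bijective f].

Definition ring_isomorphic (A B : comNzRingType) : Prop :=
  exists f : A -> B, is_ring_iso f.

Definition ring_auts (A : comNzRingType) : set (A -> A) :=
  [set f | is_ring_iso f].

Definition aut_group_isomorphic (A : comNzRingType) (gT : finGroupType) : Prop :=
  exists phi : gT -> (A -> A),
    set_bij [set: gT] (@ring_auts A) phi /\
    forall a b : gT, phi (a * b)%g = phi a \o phi b.

Definition Zcomb (A : comNzRingType) (n : nat) (b : 'I_n -> A) (c : 'rV[int]_n) : A :=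
  \sum_(i < n) b i *~ c 0 i.

Definition is_Zbasis (A : comNzRingType) (n : nat) (b : 'I_n -> A) : Prop :=
  bijective (Zcomb b).

(* The coordinates of x in b; meaningful when b is a Z-basis. *)
Definition Zcoord (A : comNzRingType) (n : nat) (b : 'I_n -> A) (x : A) : 'rV[int]_n :=
  xget 0 [set c | Zcomb b c = x].

(* Row i holds the coordinates of z * b i. *)
Definition mult_mx (A : comNzRingType) (n : nat) (b : 'I_n -> A) (z : A) : 'M[int]_n :=
  \matrix_(i < n) Zcoord b (z * b i).

Definition basis_disc (A : comNzRingType) (n : nat) (b : 'I_n -> A) : int :=
  \det (\matrix_(i < n, j < n) \tr (mult_mx b (b i * b j))).

Definition is_cubic_ring (A : comNzRingType) : Prop :=
  exists b : 'I_3 -> A, is_Zbasis b.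

Definition is_cubic_order (A : comNzRingType) : Prop :=
  is_cubic_ring A /\ GRing.integral_domain_axiom A.

(* The value does not depend on the chosen basis: a change of basis multiplies
   basis_disc by the square of a unit of Z. *)
Definition cubic_disc (A : comNzRingType) : int :=
  xget 0 [set d | exists2 b : 'I_3 -> A, is_Zbasis b & d = basis_disc b].

Definition num_iso_classes (P : comNzRingType -> Prop) (n : nat) : Prop :=
  exists S : 'I_n -> comNzRingType,
    [/\ forall i, P (S i),
        forall i j, ring_isomorphic (S i) (S j) -> i = j
      & forall A, P A -> exists i, ring_isomorphic A (S i)].

(* 'Z_3 carries its additive group structure here. *)
Definition C3_cubic_order (A : comNzRingType) : Prop :=
  is_cubic_order A /\ aut_group_isomorphic A 'Z_3.

(* Lets the Landau notations be used at +oo. *)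
Canonical pinfty_filter_on (R : numFieldType) : filter_on R :=
  FilterType (pinfty_nbhs R) (@filter_filter _ _ proper_pinfty_nbhs).

(* Main.v *)
(* A cubic order A with an automorphism s of order 3 is free over Z on 1, t, s t for
   some t: A / Z is a rank-one module over the Euclidean ring Z[zeta_3]. After a
   translation of t, multiplication is determined by two integers a, b, and
   associativity fixes the rest; the ring then has discriminant Q(a, b)^2 with
   Q(a, b) = b^2 - 3 a b + 9 a^2. Two such domains are isomorphic iff (a, b) differ by
   the group of order 4 generated by (a, b) -> (- a, - b) and (a, b) -> (a, 3 a - b),
   so the isomorphism classes of discriminant < X correspond to the lattice points in a
   quarter of the ellipse Q < sqrt X for which the ring is a domain. The quarter
   ellipse has area pi sqrt X / (6 sqrt 3) and boundary of length O(X^(1/4)). If the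
   ring is not a domain then, for some k, x, y,
   (a, b) = k (x y (x - y), x^3 - 3 x y^2 + y^3) and Q = k^2 (x^2 - x y + y^2)^3, so
   there are O(X^(1/4)) such points by convergence of the sum of n^(-3/2). *)
Require Import Defs.
From HB Require Import structures.
From mathcomp Require Import all_boot all_order all_algebra all_fingroup.
From mathcomp Require Import all_classical all_reals all_analysis.
From mathcomp Require Import ring lra zify.

Set Implicit Arguments.
Unset Strict Implicit.
Unset Printing Implicit Defensive.

Import Order.TTheory GRing.Theory Num.Theory.
Import numFieldNormedType.Exports.

Local Open Scope classical_set_scope.
Local Open Scope ring_scope.

(** * The ring attached to (a, b) *)

(** A triple holds the coordinates on 1, t, t'. Indexing the type by (a, b) lets each pair carry its
    own multiplication as a canonical structure. *)
Record c3ring (a b : int) := C3ring { c3_0 : int; c3_1 : int; c3_2 : int }.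

Arguments C3ring {a b}.

Section C3ring.
Variables a b : int.
Local Notation T := (c3ring a b).

Definition c3_triple (u : T) := (c3_0 u, c3_1 u, c3_2 u).
Definition triple_c3 (t : int * int * int) : T := C3ring t.1.1 t.1.2 t.2.

Lemma c3_tripleK : cancel c3_triple triple_c3.
Proof. by case. Qed.

HB.instance Definition _ := Equality.copy T (can_type c3_tripleK).
HB.instance Definition _ := Choice.copy T (can_type c3_tripleK).

Lemma c3_eq (u v : T) :
  c3_0 u = c3_0 v -> c3_1 u = c3_1 v -> c3_2 u = c3_2 v -> u = v.
Proof. by case: u v => [? ? ?] [? ? ?] /= -> -> ->. Qed.

Definition c3_add (u v : T) : T :=
  C3ring (c3_0 u + c3_0 v) (c3_1 u + c3_1 v) (c3_2 u + c3_2 v).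
Definition c3_opp (u : T) : T := C3ring (- c3_0 u) (- c3_1 u) (- c3_2 u).

Lemma c3_addA : associative c3_add.
Proof. by move=> u v w; apply: c3_eq; rewrite /= addrA. Qed.
Lemma c3_addC : commutative c3_add.
Proof. by move=> u v; apply: c3_eq; rewrite /= addrC. Qed.
Lemma c3_add0 : left_id (C3ring 0 0 0) c3_add.
Proof. by move=> u; apply: c3_eq; rewrite /= add0r. Qed.
Lemma c3_addN : left_inverse (C3ring 0 0 0) c3_opp c3_add.
Proof. by move=> u; apply: c3_eq; rewrite /= addNr. Qed.

HB.instance Definition _ :=
  GRing.isZmodule.Build T c3_addA c3_addC c3_add0 c3_addN.

(* With t = (0,1,0) and t' = (0,0,1): t * t' = - a^2 + a t,
   t^2 = (2 a^2 - a b) + b t + a t', t'^2 = 2 a^2 - a t + (b - a) t'.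
   These are the Delone-Faddeev relations of the binary cubic form
   (a, b, b - 3 a, - a), up to a translation of the basis. *)
Definition c3_mul (u v : T) : T :=
  let: C3ring k x y := u in let: C3ring l z w := v in
  C3ring
    (k * l + x * z * (2 * a ^+ 2 - a * b) - (x * w + z * y) * a ^+ 2
       + y * w * (2 * a ^+ 2))
    (k * z + l * x + x * z * b + (x * w + z * y) * a - y * w * a)
    (k * w + l * y + x * z * a + y * w * (b - a)).

Lemma c3_mulA : associative c3_mul.
Proof. by move=> [? ? ?] [? ? ?] [? ? ?]; apply: c3_eq => /=; ring. Qed.
Lemma c3_mulC : commutative c3_mul.
Proof. by move=> [? ? ?] [? ? ?]; apply: c3_eq => /=; ring. Qed.
Lemma c3_mul1 : left_id (C3ring 1 0 0) c3_mul.
Proof. by move=> [? ? ?]; apply: c3_eq => /=; ring. Qed.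
Lemma c3_mulD : left_distributive c3_mul c3_add.
Proof. by move=> [? ? ?] [? ? ?] [? ? ?]; apply: c3_eq => /=; ring. Qed.
Lemma c3_one_neq0 : (C3ring 1 0 0 : T) != 0.
Proof. by apply/eqP => -[]. Qed.

HB.instance Definition _ :=
  GRing.Zmodule_isComNzRing.Build T c3_mulA c3_mulC c3_mul1 c3_mulD c3_one_neq0.

Lemma c3_0E : (0 : T) = C3ring 0 0 0. Proof. by []. Qed.
Lemma c3_1E : (1 : T) = C3ring 1 0 0. Proof. by []. Qed.
Lemma c3_addE k x y l z w :
  (C3ring k x y + C3ring l z w : T) = C3ring (k + l) (x + z) (y + w).
Proof. by []. Qed.
Lemma c3_oppE k x y : (- C3ring k x y : T) = C3ring (- k) (- x) (- y).
Proof. by []. Qed.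
Lemma c3_mulE (u v : T) : u * v = c3_mul u v. Proof. by []. Qed.

Lemma c3_intmul (n k x y : int) :
  (C3ring k x y : T) *~ n = C3ring (n * k) (n * x) (n * y).
Proof.
elim: n => [|n IH|n IH].
- by rewrite mulr0z c3_0E !mul0r.
- by rewrite intS mulrzDr mulr1z IH c3_addE; congr C3ring; ring.
- by rewrite -addn1 PoszD opprD mulrzDr mulrN1z IH c3_oppE c3_addE; congr C3ring; ring.
Qed.

Lemma c3_intr (n : int) : (n%:~R : T) = C3ring n 0 0.
Proof. by rewrite c3_1E c3_intmul mulr1 !mulr0. Qed.

(** The automorphism t -> t' -> b - t - t'; on the quotient by Z it acts as zeta_3. *)
Definition c3_sigma (u : T) : T :=
  let: C3ring k x y := u in C3ring (k + y * b) (- y) (x - y).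

Lemma c3_sigma3 (u : T) : c3_sigma (c3_sigma (c3_sigma u)) = u.
Proof. by case: u => k x y; apply: c3_eq => /=; ring. Qed.

Lemma c3_sigmaB : GRing.zmod_morphism c3_sigma.
Proof.
by move=> [k x y] [l z w]; rewrite c3_oppE c3_addE; apply: c3_eq => /=; ring.
Qed.

Lemma c3_sigmaM : GRing.monoid_morphism c3_sigma.
Proof.
split; first by apply: c3_eq => /=; ring.
by move=> [k x y] [l z w]; apply: c3_eq => /=; ring.
Qed.

Lemma c3_sigma0 : c3_sigma 0 = 0.
Proof. by apply: c3_eq => /=; ring. Qed.

Lemma c3_sigmaMul u v : c3_sigma (u * v) = c3_sigma u * c3_sigma v.
Proof. by case: c3_sigmaM => _; apply. Qed.

Lemma c3_sigma_iso : is_ring_iso c3_sigma.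
Proof.
split; [exact: c3_sigmaB | exact: c3_sigmaM |].
by exists (c3_sigma \o c3_sigma) => u /=; rewrite c3_sigma3.
Qed.

Definition c3_t : T := C3ring 0 1 0.
Definition c3_t' : T := C3ring 0 0 1.

Lemma c3_decomp (u : T) :
  u = (c3_0 u)%:~R + c3_t *~ c3_1 u + c3_t' *~ c3_2 u.
Proof.
case: u => k x y; rewrite c3_intr !c3_intmul !c3_addE /=.
by apply: c3_eq => /=; ring.
Qed.

Lemma c3_mulrz_eq0 (u : T) (n : int) : u *~ n = 0 -> n != 0 -> u = 0.
Proof.
case: u => k x y; rewrite c3_intmul => -[h0 h1 h2] n0.
apply: c3_eq => /=.
- by move/eqP: h0; rewrite mulf_eq0 (negPf n0) => /eqP.
- by move/eqP: h1; rewrite mulf_eq0 (negPf n0) => /eqP.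
- by move/eqP: h2; rewrite mulf_eq0 (negPf n0) => /eqP.
Qed.

Lemma c3_trace (u : T) :
  u + c3_sigma u + c3_sigma (c3_sigma u) = (3 * c3_0 u + b * (c3_1 u + c3_2 u))%:~R.
Proof.
by case: u => k x y; rewrite c3_intr /= !c3_addE; apply: c3_eq => /=; ring.
Qed.

Lemma c3_norm (u : T) :
  exists n : int, u * c3_sigma u * c3_sigma (c3_sigma u) = n%:~R.
Proof.
case: u => k x y; rewrite !c3_mulE.
(* The witness is the constant coordinate; the other two vanish, the product being fixed by
   sigma. *)
exists (c3_0 (c3_mul (c3_mul (C3ring k x y) (c3_sigma (C3ring k x y)))
   (c3_sigma (c3_sigma (C3ring k x y))))).
by rewrite c3_intr; apply: c3_eq => //=; ring.
Qed.

(* A zero divisor u yields w != 0 with w * sigma w = 0, hence also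
   w * sigma^2 w = 0 and w^2 = (trace w) w: the elements 1, w, w^2 are
   dependent, and the index form vanishes at w. *)
Lemma c3_not_domain :
  ~ GRing.integral_domain_axiom T ->
  exists x y : int, (x != 0) || (y != 0) /\
    a * (x ^+ 3 - 3 * x * y ^+ 2 + y ^+ 3) = b * (x * y * (x - y)).
Proof.
move=> nd.
have [w [w0 ww]] : exists w : T, w <> 0 /\ w * c3_sigma w = 0.
  apply: contrapT => H; apply: nd => u v uv0.
  have [//|/eqP u0] := eqVneq u 0.
  have [//|/eqP v0] := eqVneq v 0.
  exfalso.
  (* The norm n of u kills v, so n = 0. Take w = u if sigma u * sigma^2 u = 0, and that product
     otherwise. *)
  have [n nE] := c3_norm u.
  have n0 : n = 0.
    apply/eqP; apply: contrapT => /negP n0; apply: v0; apply: (@c3_mulrz_eq0 _ n) => //.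
    by rewrite -mulrzr -nE mulrA (mulrA v) (mulrC v u) uv0 !mul0r.
  have [e0|/eqP e0] := eqVneq (c3_sigma u * c3_sigma (c3_sigma u)) 0.
    apply: H; exists u; split=> //.
    have : c3_sigma (c3_sigma (c3_sigma u * c3_sigma (c3_sigma u))) = 0.
      by rewrite e0 !c3_sigma0.
    by rewrite !c3_sigmaMul !c3_sigma3.
  apply: H; exists (c3_sigma u * c3_sigma (c3_sigma u)); split=> //.
  have -> : c3_sigma u * c3_sigma (c3_sigma u) * c3_sigma (c3_sigma u * c3_sigma (c3_sigma u))
     = u * c3_sigma u * c3_sigma (c3_sigma u) * c3_sigma (c3_sigma u).
    by rewrite c3_sigmaMul c3_sigma3; ring.
  by rewrite nE n0 mulr0z mul0r.
have ww2 : w * c3_sigma (c3_sigma w) = 0.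
  have : c3_sigma (c3_sigma (w * c3_sigma w)) = 0 by rewrite ww !c3_sigma0.
  by rewrite !c3_sigmaMul c3_sigma3 mulrC.
have : w * w = w * (w + c3_sigma w + c3_sigma (c3_sigma w)).
  by rewrite !mulrDr ww ww2 !addr0.
rewrite c3_trace mulrzr.
case: w w0 ww {ww2} => k x y w0 ww; rewrite c3_intmul => -[_ h1 h2].
exists x, y; split.
  (* If x = y = 0, then w = k and the constant coordinate of w * sigma w is k^2. *)
  apply: contrapT => /negP; rewrite negb_or !negbK => /andP[/eqP x0 /eqP y0].
  apply: w0; rewrite x0 y0 in ww *; case: ww => + _ _.
  have -> : forall c, k * (k + 0 * b) + 0 * - 0 * c -
    (0 * (0 - 0) + - 0 * 0) * a ^+ 2 + 0 * (0 - 0) * (2 * a ^+ 2) = k ^+ 2.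
    by move=> c; ring.
  by move/eqP; rewrite sqrf_eq0 => /eqP ->.
(* Eliminating the trace between the t and t' coordinates of w^2 = (trace w) w leaves the index
   form. *)
move: (congr1 ( *%R y) h1) (congr1 ( *%R x) h2) => /= e1 e2.
lia.
Qed.

Section Domain.
Hypothesis domT : GRing.integral_domain_axiom T.

Lemma c3_domain_a_neq0 : a != 0.
Proof.
apply/eqP => a0.
have : c3_t * c3_t' = 0 by apply: c3_eq => /=; rewrite a0; ring.
by move/domT => /orP[] /eqP.
Qed.

End Domain.
End C3ring.

(** * Coordinates and discriminants *)

(** Entries come from a function of naturals so that they compute at numerals. *)
Lemma det_mx33 (K : comNzRingType) (F : nat -> nat -> K) :
  \det (\matrix_(i < 3, j < 3) F i j) =
    F 0%N 0%N * (F 1%N 1%N * F 2%N 2%N - F 1%N 2%N * F 2%N 1%N)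
    - F 0%N 1%N * (F 1%N 0%N * F 2%N 2%N - F 1%N 2%N * F 2%N 0%N)
    + F 0%N 2%N * (F 1%N 0%N * F 2%N 1%N - F 1%N 1%N * F 2%N 0%N).
Proof.
rewrite (expand_det_row _ 0) !big_ord_recl big_ord0 /cofactor.
rewrite !(expand_det_row _ 0) !big_ord_recl !big_ord0 /cofactor !det_mx11 !mxE.
rewrite /= /bump /= !expr0 !expr1 !(addn0, add0n) ?expr1 ?exprS ?expr0.
ring.
Qed.

Lemma ring_iso_rmorph (A B : comNzRingType) (f : A -> B) :
  is_ring_iso f -> exists g : {rmorphism A -> B}, g = f :> (A -> B).
Proof.
move=> [fB fM _].
pose m1 := GRing.isZmodMorphism.Build A B f fB.
pose m2 := GRing.isMonoidMorphism.Build A B f fM.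
by pose g : {rmorphism A -> B} := HB.pack f m1 m2; exists g.
Qed.

Section Zcoord.
Variables (A : comNzRingType) (n : nat).
Implicit Types (z : 'I_n -> A).

Lemma ZcombB z : GRing.zmod_morphism (Zcomb z).
Proof.
move=> c d; rewrite /Zcomb -sumrB; apply: eq_bigr => i _.
by rewrite !mxE mulrzBr.
Qed.

Lemma ZcombZ z (m : int) c : Zcomb z (m *: c) = Zcomb z c *~ m.
Proof.
rewrite /Zcomb mulrz_suml; apply: eq_bigr => i _.
by rewrite !mxE mulrC mulrzA.
Qed.

Lemma Zcomb_sum z m (v : 'rV[int]_m) (c : 'I_m -> 'rV[int]_n) :
  Zcomb z (\sum_i v 0 i *: c i) = \sum_i Zcomb z (c i) *~ v 0 i.
Proof.
have Z0 : Zcomb z 0 = 0 by rewrite -[in LHS](subrr 0) ZcombB subrr.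
have ZD c1 c2 : Zcomb z (c1 + c2) = Zcomb z c1 + Zcomb z c2.
  by rewrite -[c2]opprK ZcombB -[- - c2]add0r !ZcombB Z0 sub0r.
elim/big_rec2: _ => [|i x y _ <-] //.
by rewrite ZD ZcombZ.
Qed.

Variable b : 'I_n -> A.
Hypothesis bb : is_Zbasis b.

Lemma ZcombK : cancel (Zcomb b) (Zcoord b).
Proof.
have [g gK _] := bb => c; apply: (can_inj gK).
by rewrite /Zcoord; case: xgetP => // /(_ c); case.
Qed.

Lemma ZcoordK : cancel (Zcoord b) (Zcomb b).
Proof. by have [g _ gK] := bb => x; rewrite -[x in LHS]gK ZcombK gK. Qed.

Lemma Zcoord_inj : injective (Zcoord b).
Proof. exact: can_inj ZcoordK. Qed.

Lemma ZcoordB : GRing.zmod_morphism (Zcoord b).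
Proof. by move=> x y; rewrite -[x in LHS]ZcoordK -[y in LHS]ZcoordK -ZcombB ZcombK. Qed.

Lemma Zcoord0 : Zcoord b 0 = 0.
Proof. by rewrite -[in LHS](subrr 0) ZcoordB subrr. Qed.

Lemma ZcoordMz x (m : int) : Zcoord b (x *~ m) = m *: Zcoord b x.
Proof. by rewrite -[x in LHS]ZcoordK -ZcombZ ZcombK. Qed.

Definition coord_mx m (z : 'I_m -> A) : 'M[int]_(m, n) :=
  \matrix_(i < m) Zcoord b (z i).

Lemma Zcoord_Zcomb m (z : 'I_m -> A) v :
  Zcoord b (Zcomb z v) = v *m coord_mx z.
Proof.
rewrite mulmx_sum_row; under eq_bigr do rewrite rowK.
apply: (can_inj ZcombK); rewrite ZcoordK Zcomb_sum /Zcomb.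
by apply: eq_bigr => i _; rewrite -/(Zcomb b _) ZcoordK.
Qed.

Lemma coord_mx_mul m k (z : 'I_m -> A) (y : 'I_k -> A) (P : 'M[int]_(k, m)) :
  (forall i, y i = Zcomb z (row i P)) -> coord_mx y = P *m coord_mx z.
Proof.
by move=> yP; apply/row_matrixP => i; rewrite rowK yP Zcoord_Zcomb row_mul.
Qed.

Lemma coord_mx_id : coord_mx b = 1%:M.
Proof.
apply/row_matrixP => i; rewrite rowK row1; apply: (can_inj ZcombK).
rewrite ZcoordK /Zcomb (bigD1 i) //= !mxE !eqxx mulr1z big1 ?addr0 // => j /negPf ji.
by rewrite mxE ji andbF mulr0z.
Qed.

Lemma Zbasis_mulrz_eq0 (x : A) (m : int) : x *~ m = 0 -> m != 0 -> x = 0.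
Proof.
move=> /(congr1 (Zcoord b)); rewrite ZcoordMz Zcoord0 => /eqP.
rewrite scalemx_eq0 => /orP[/eqP -> /eqP //|/eqP + _].
by rewrite -Zcoord0 => /Zcoord_inj.
Qed.

(** Padding the coordinate matrix with a zero column gives a singular square matrix; an integer
    vector in its left kernel is the relation. *)
Lemma Zbasis_dependent (z : 'I_n.+1 -> A) :
  exists2 v : 'rV[int]_n.+1, v != 0 & Zcomb z v = 0.
Proof.
pose M := coord_mx z.
pose M' : 'M[int]_n.+1 :=
  \matrix_(i, j) if unlift ord_max j is Some k then M i k else 0.
have : \det M' = 0.
  rewrite (expand_det_col _ ord_max) big1 // => i _.
  by rewrite mxE unlift_none mul0r.
move/eqP/det0P => [v v0 vM]; exists v => //; apply: Zcoord_inj.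
rewrite Zcoord_Zcomb Zcoord0; apply/rowP => j.
move/rowP/(_ (lift ord_max j)): vM; rewrite !mxE => vM.
by rewrite -[RHS]vM; apply: eq_bigr => i _; rewrite [M' _ _]mxE liftK.
Qed.

Lemma Zdet_eq0 z :
  \det (coord_mx z) = 0 -> exists2 v : 'rV[int]_n, v != 0 & Zcomb z v = 0.
Proof.
move/eqP/det0P => [v v0 vM]; exists v => //; apply: Zcoord_inj.
by rewrite Zcoord_Zcomb vM Zcoord0.
Qed.

(** Cramer's rule: the adjugate supplies the coefficients without division. *)
Lemma Zcramer z x : exists v, x *~ \det (coord_mx z) = Zcomb z v.
Proof.
exists (Zcoord b x *m \adj (coord_mx z)); apply: Zcoord_inj.
by rewrite Zcoord_Zcomb -mulmxA mul_adj_mx mul_mx_scalar ZcoordMz.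
Qed.

(** Multiplying by a basis element b i and reading its i-th coordinate shows that d divides k;
    torsion-freeness then cancels d. The basis is not assumed to contain 1. *)
Lemma Zbasis_intr (x : A) (d k : int) :
  (0 < n)%N -> d != 0 -> x *~ d = k%:~R -> exists m : int, x = m%:~R.
Proof.
move=> n0 d0 xd; pose i := Ordinal n0.
have : Zcoord b (x *~ d * b i) 0 i = d * Zcoord b (x * b i) 0 i.
  by rewrite mulrzAl ZcoordMz mxE.
rewrite xd mulrzl ZcoordMz mxE.
have -> : Zcoord b (b i) 0 i = 1.
  by move/row_matrixP/(_ i): coord_mx_id; rewrite rowK row1 => ->; rewrite mxE !eqxx.
rewrite mulr1 => kE; exists (Zcoord b (x * b i) 0 i).
apply/eqP; rewrite -subr_eq0; apply/eqP.
apply: (@Zbasis_mulrz_eq0 _ d) => //.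
by rewrite mulrzBl xd kE mulrC mulrzA subrr.
Qed.

End Zcoord.

Lemma int_unit_sqr (m k : int) : m * k = 1 -> m ^+ 2 = 1.
Proof.
move=> /(congr1 absz); rewrite abszM => /eqP; rewrite muln_eq1 => /andP[/eqP m1 _].
by have [->|->] : m = 1 \/ m = -1 by lia.
Qed.

(** * Invariance of the discriminant under change of basis *)

Section BaseChange.
Variables (A : comNzRingType) (n : nat) (b b' : 'I_n -> A).
Hypotheses (bb : is_Zbasis b) (bb' : is_Zbasis b').

Local Notation P := (coord_mx b b').

Lemma Zcomb_row_coord_mx (d : 'I_n -> A) (bd : is_Zbasis d) m (z : 'I_m -> A) i :
  Zcomb d (row i (coord_mx d z)) = z i.
Proof. by rewrite rowK ZcoordK. Qed.

Lemma base_changeK : P *m coord_mx b' b = 1%:M.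
Proof.
rewrite -(coord_mx_id bb'); apply/esym/coord_mx_mul => // i.
by rewrite Zcomb_row_coord_mx.
Qed.

Lemma mult_mx_base_change (z : A) :
  mult_mx b' z = P *m (mult_mx b z *m coord_mx b' b).
Proof.
rewrite -[mult_mx b' z]/(coord_mx b' (fun i => z * b' i)).
rewrite -(@coord_mx_mul _ _ _ bb' _ _ b (fun i => z * b i)); last first.
  by move=> i; rewrite rowK ZcoordK.
apply: coord_mx_mul => // i; rewrite -[b' i in LHS](Zcomb_row_coord_mx bb b' i).
by rewrite /Zcomb mulr_sumr; apply: eq_bigr => j _; rewrite mulrzAr.
Qed.

Lemma tr_mult_mx_base_change z : \tr (mult_mx b' z) = \tr (mult_mx b z).
Proof.
by rewrite mult_mx_base_change mxtrace_mulC -mulmxA (mulmx1C base_changeK) mulmx1.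
Qed.

Lemma tr_mult_mx_Zcomb m (z : 'I_m -> A) v :
  \tr (mult_mx b (Zcomb z v)) = \sum_i v 0 i * \tr (mult_mx b (z i)).
Proof.
rewrite /mxtrace; under [RHS]eq_bigr do rewrite mulr_sumr.
rewrite [RHS]exchange_big; apply: eq_bigr => i _; rewrite mxE.
have -> : Zcomb z v * b i = Zcomb (fun j => z j * b i) v.
  by rewrite /Zcomb mulr_suml; apply: eq_bigr => j _; rewrite mulrzAl.
by rewrite Zcoord_Zcomb // mxE; apply: eq_bigr => j _; rewrite !mxE.
Qed.

(** By bilinearity the Gram matrix of the trace form becomes P T P^T, and det P is a unit of Z, of
    square 1. *)
Lemma basis_disc_base_change : basis_disc b' = basis_disc b.
Proof.
rewrite /basis_disc.
set T := \matrix_(i, j) \tr (mult_mx b (b i * b j)).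
have -> : \matrix_(i, j) \tr (mult_mx b' (b' i * b' j)) = P *m T *m P^T.
  apply/matrixP => i j; rewrite !mxE tr_mult_mx_base_change.
  transitivity (\tr (mult_mx b (Zcomb b (row i P) * Zcomb b (row j P)))).
    by rewrite !Zcomb_row_coord_mx.
  rewrite [X in mult_mx b X](_ : _ = Zcomb (fun k =>
     Zcomb b (row i P) * b k) (row j P)); last first.
    by rewrite /Zcomb mulr_sumr; apply: eq_bigr => k _; rewrite mulrzAr.
  rewrite tr_mult_mx_Zcomb; apply: eq_bigr => k _.
  rewrite [RHS]mulrC !mxE; congr (_ * _).
  rewrite [X in mult_mx b X](_ : _ = Zcomb (fun l => b l * b k) (row i P)); last first.
    by rewrite /Zcomb mulr_suml; apply: eq_bigr => l _; rewrite mulrzAl.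
  by rewrite tr_mult_mx_Zcomb; apply: eq_bigr => l _; rewrite !mxE.
rewrite !det_mulmx det_tr mulrAC -expr2.
have := congr1 determinant base_changeK; rewrite det_mulmx det1.
by move/int_unit_sqr ->; rewrite mul1r.
Qed.

End BaseChange.

(** The basis b makes the set in [cubic_disc] inhabited, so the default 0 of [xget] is not taken. *)
Lemma cubic_discE (A : comNzRingType) (b : 'I_3 -> A) :
  is_Zbasis b -> cubic_disc A = basis_disc b.
Proof.
move=> bb; rewrite /cubic_disc; case: xgetP => [d _ [b' bb' ->]|/(_ (basis_disc b))].
  exact: basis_disc_base_change.
by case; exists b.
Qed.

Definition tri (T : Type) (p q r : T) (i : 'I_3) : T := nth p [:: p; q; r] i.
Definition row3 (k x y : int) : 'rV[int]_3 := \row_i tri k x y i.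

Lemma row3_eta (v : 'rV[int]_3) : exists k x y, v = row3 k x y.
Proof.
exists (v 0 ord0), (v 0 (lift ord0 ord0)), (v 0 (lift ord0 (lift ord0 ord0))).
apply/rowP => -[[|[|[|//]]] i3]; rewrite !mxE /tri /=; congr (v _ _); exact/val_inj.
Qed.

Lemma row3_inj k x y l z w : row3 k x y = row3 l z w -> [/\ k = l, x = z & y = w].
Proof.
move=> /rowP E.
by split; [move: (E ord0) | move: (E (lift ord0 ord0))
  | move: (E (lift ord0 (lift ord0 ord0)))]; rewrite !mxE.
Qed.

Section Tri.
Variable A : comNzRingType.
Implicit Types p q r : A.

Lemma Zcomb_tri p q r k x y :
  Zcomb (tri p q r) (row3 k x y) = p *~ k + q *~ x + r *~ y.
Proof. by rewrite /Zcomb !big_ord_recl big_ord0 !mxE /tri /= addr0 addrA. Qed.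

Lemma is_Zbasis_tri p q r :
  is_Zbasis (tri p q r) <->
  (forall z, exists k x y, z = p *~ k + q *~ x + r *~ y) /\
  (forall k x y, p *~ k + q *~ x + r *~ y = 0 -> [/\ k = 0, x = 0 & y = 0]).
Proof.
split=> [bb|[gen free]].
  split=> [z|k x y].
    have [k [x [y E]]] := row3_eta (Zcoord (tri p q r) z).
    by exists k, x, y; rewrite -Zcomb_tri -E ZcoordK.
  rewrite -Zcomb_tri => E; apply: row3_inj; apply: (can_inj (ZcombK bb)).
  by rewrite E Zcomb_tri !mulr0z !addr0.
(* The coordinates provided by gen are packed into a row vector; choice turns them into a coordinate
   map g. *)
have [g gP] := choice (fun z => let: ex_intro k (ex_intro x (ex_intro y E)) := gen z in
   ex_intro (fun v => z = Zcomb (tri p q r) v) (row3 k x y) (etrans E (esym (Zcomb_tri p q r k x y)))).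
have inj c d : Zcomb (tri p q r) c = Zcomb (tri p q r) d -> c = d.
  move=> E; apply/eqP; rewrite -subr_eq0; apply/eqP.
  have [k [x [y cE]]] := row3_eta (c - d).
  have : Zcomb (tri p q r) (c - d) = 0 by rewrite ZcombB E subrr.
  rewrite cE Zcomb_tri => /free [-> -> ->].
  by apply/rowP => -[[|[|[|//]]] i3]; rewrite !mxE.
exists g => z; last by rewrite -gP.
by apply: inj; rewrite -gP.
Qed.

End Tri.

Lemma Zbasis_tri_free (A : comNzRingType) (u v : A) (k x y l z w : int) :
  is_Zbasis (tri 1 u v) ->
  k%:~R + u *~ x + v *~ y = l%:~R + u *~ z + v *~ w -> [/\ k = l, x = z & y = w].
Proof.
move=> /is_Zbasis_tri[_ H] E.
have : (k - l)%:~R + u *~ (x - z) + v *~ (y - w) = 0.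
  move/eqP: E; rewrite -subr_eq0 => /eqP <-; ring.
by move=> /H [? ? ?]; split; lia.
Qed.

(** The multiplication table of t, t' in [c3ring a b], imposed on a basis 1, u, v of an arbitrary
    ring. *)
Definition c3_basis (A : comNzRingType) (a b : int) (u v : A) : Prop :=
  is_Zbasis (tri 1 u v) /\
  [/\ u * v = u *~ a - (a ^+ 2)%:~R,
      u * u = (2 * a ^+ 2 - a * b)%:~R + u *~ b + v *~ a
    & v * v = (2 * a ^+ 2)%:~R - u *~ a + v *~ (b - a)].

(** * Rings with a basis of type (a, b) *)

Lemma ring_iso_comp (A B C : comNzRingType) (f : A -> B) (g : B -> C) :
  is_ring_iso f -> is_ring_iso g -> is_ring_iso (g \o f).
Proof.
move=> [fB [f1 fM] fbij] [gB [g1 gM] gbij]; split; last exact: bij_comp.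
- by move=> x y; rewrite /= fB gB.
- by split=> [|x y]; rewrite /= ?f1 ?fM.
Qed.

Lemma ring_iso_inv (A B : comNzRingType) (f : A -> B) (g : B -> A) :
  is_ring_iso f -> cancel f g -> cancel g f -> is_ring_iso g.
Proof.
move=> [fB [f1 fM] _] fK gK; split; last by exists f.
- by move=> x y; rewrite -{1}(gK x) -{1}(gK y) -fB fK.
- by split=> [|x y]; [rewrite -f1 fK | rewrite -{1}(gK x) -{1}(gK y) -fM fK].
Qed.

Lemma ring_isomorphic_sym (A B : comNzRingType) :
  ring_isomorphic A B -> ring_isomorphic B A.
Proof.
by move=> [f fiso]; have [_ _ [g fK gK]] := fiso; exists g; apply: ring_iso_inv gK.
Qed.

Section C3Basis.
Variables (A : comNzRingType) (a b : int) (u v : A).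
Hypothesis uv_basis : c3_basis a b u v.

Lemma c3_basis_gen z : exists k x y : int, z = k%:~R + u *~ x + v *~ y.
Proof. by have [H _] := (is_Zbasis_tri 1 u v).1 uv_basis.1; apply: H. Qed.

Lemma c3_basis_free (k x y l z w : int) :
  k%:~R + u *~ x + v *~ y = l%:~R + u *~ z + v *~ w -> [/\ k = l, x = z & y = w].
Proof. exact: Zbasis_tri_free uv_basis.1. Qed.

Lemma c3_basis_iso : ring_isomorphic A (c3ring a b).
Proof.
apply: ring_isomorphic_sym.
have [_ [uv uu vv]] := uv_basis.
pose f (z : c3ring a b) : A := (c3_0 z)%:~R + u *~ c3_1 z + v *~ c3_2 z.
exists f; split.
- by move=> [k x y] [l z w]; rewrite /f c3_oppE c3_addE /=; ring.
- split; first by rewrite /f /=; ring.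
  move=> [k x y] [l z w]; rewrite /f c3_mulE /=.
  transitivity ((k * l)%:~R + u *~ (k * z + l * x) + v *~ (k * w + l * y)
     + (u * u) *~ (x * z) + (u * v) *~ (x * w + z * y) + (v * v) *~ (y * w)).
    by rewrite uv uu vv; ring.
  ring.
have finj : injective f.
  move=> [k x y] [l z w]; rewrite /f /= => E.
  by have [-> -> ->] := c3_basis_free E.
have fsurj z : exists c, f c = z.
  by have [k [x [y ->]]] := c3_basis_gen z; exists (C3ring k x y).
have [g gK] := choice fsurj.
by exists g => // z; apply: finj; rewrite gK.
Qed.

Lemma c3_basisN : c3_basis (- a) (- b) (- u) (- v).
Proof.
have [_ [uv uu vv]] := uv_basis.
split; last by rewrite !mulrNN uv uu vv; split; ring.
apply/is_Zbasis_tri; split=> [z|k x y E].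
  by have [k [x [y ->]]] := c3_basis_gen z; exists k, (- x), (- y); ring.
have [|? ? ?] := @c3_basis_free k (- x) (- y) 0 0 0; last by split; lia.
by transitivity (1 *~ k + (- u) *~ x + (- v) *~ y); [ring | rewrite E; ring].
Qed.

(** This exchanges the generator sigma of the group for its inverse: with sigma u = v and sigma v =
    b - u - v, the new pair is a - u and sigma^2 (a - u) = a - b + u + v. *)
Lemma c3_basis_flip : c3_basis a (3 * a - b) (a%:~R - u) (a%:~R - b%:~R + u + v).
Proof.
have [_ [uv uu vv]] := uv_basis; split; last split.
- apply/is_Zbasis_tri; split=> [z|k x y E].
    have [k [x [y ->]]] := c3_basis_gen z.
    by exists (k - a * (y - x) - (a - b) * y), (y - x), y; ring.
  have [|? ? ?] := @c3_basis_free (k + a * x + (a - b) * y) (y - x) y 0 0 0; last by split; lia.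
  by transitivity (1 *~ k + (a%:~R - u) *~ x + (a%:~R - b%:~R + u + v) *~ y);
    [ring | rewrite E; ring].
- transitivity (a%:~R * (a - b)%:~R + v *~ a + u *~ b - u * u - u * v); first by ring.
  by rewrite uv uu; ring.
- transitivity ((a ^+ 2)%:~R - u *~ (2 * a) + u * u); first by ring.
  by rewrite uu; ring.
- transitivity (((a - b) ^+ 2)%:~R + (u + v) *~ (2 * (a - b)) + u * u + (u * v) *~ 2 + v * v).
    ring.
  by rewrite uu uv vv; ring.
Qed.

Lemma c3_basis_tr (k x y : int) :
  \tr (mult_mx (tri 1 u v) (k%:~R + u *~ x + v *~ y)) = 3 * k + b * (x + y).
Proof.
have [bb [uv uu vv]] := uv_basis.
have Zc z l p q : z = l%:~R + u *~ p + v *~ q -> Zcoord (tri 1 u v) z = row3 l p q.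
  by move=> ->; rewrite -[l%:~R]/(1 *~ l) -Zcomb_tri ZcombK.
have -> : k%:~R + u *~ x + v *~ y = Zcomb (tri 1 u v) (row3 k x y).
  by rewrite Zcomb_tri.
rewrite tr_mult_mx_Zcomb // !big_ord_recl big_ord0 /mxtrace !big_ord_recl !big_ord0.
rewrite !mxE /tri /=.
rewrite (mulrC u 1) (mulrC v 1) (mulrC v u).
rewrite (Zc (1 * 1) 1 0 0); last by ring.
rewrite (Zc (1 * u) 0 1 0); last by ring.
rewrite (Zc (1 * v) 0 0 1); last by ring.
rewrite (Zc (u * u) (2 * a ^+ 2 - a * b) b a); last by rewrite uu; ring.
rewrite (Zc (u * v) (- a ^+ 2) a 0); last by rewrite uv; ring.
rewrite (Zc (v * v) (2 * a ^+ 2) (- a) (b - a)); last by rewrite vv; ring.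
by rewrite !mxE /tri /=; ring.
Qed.

Lemma c3_basis_disc : cubic_disc A = (b ^+ 2 - 3 * a * b + 9 * a ^+ 2) ^+ 2.
Proof.
have [bb [uv uu vv]] := uv_basis.
rewrite (cubic_discE bb) /basis_disc.
pose F (i j : nat) := \tr (mult_mx (tri 1 u v) (nth 1 [:: 1; u; v] i * nth 1 [:: 1; u; v] j)).
rewrite -[X in \det X]/(\matrix_(i < 3, j < 3) F i j) det_mx33 /F /=.
have T z k x y : z = k%:~R + u *~ x + v *~ y ->
    \tr (mult_mx (tri 1 u v) z) = 3 * k + b * (x + y).
  by move=> ->; apply: c3_basis_tr.
rewrite (mulrC u 1) (mulrC v 1) (mulrC v u).
rewrite (T (1 * 1) 1 0 0); last by ring.
rewrite (T (1 * u) 0 1 0); last by ring.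
rewrite (T (1 * v) 0 0 1); last by ring.
rewrite (T (u * u) (2 * a ^+ 2 - a * b) b a); last by rewrite uu; ring.
rewrite (T (u * v) (- a ^+ 2) a 0); last by rewrite uv; ring.
rewrite (T (v * v) (2 * a ^+ 2) (- a) (b - a)); last by rewrite vv; ring.
ring.
Qed.

End C3Basis.

Lemma c3ring_basis a b : c3_basis a b (c3_t a b) (c3_t' a b).
Proof.
split; last first.
  by split; rewrite ?c3_intmul ?c3_intr /c3_t /c3_t' ?c3_oppE ?c3_addE; apply: c3_eq => /=; ring.
apply/is_Zbasis_tri; split=> [z|k x y].
  by exists (c3_0 z), (c3_1 z), (c3_2 z); exact: c3_decomp.
rewrite c3_intr !c3_intmul !c3_addE => -[].
by rewrite !(mulr0, mulr1, add0r, addr0) => -> -> ->.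
Qed.

(** * Orders with an automorphism of order 3 *)

Lemma round_div (x d : int) : d != 0 -> exists m : int, 2 * `|x - m * d| <= `|d|.
Proof.
move=> d0; have E := divz_eq x d; have r0 := modz_ge0 x d0; have rd := ltz_mod x d0.
have [h|h] := lerP (2 * (x %% d)%Z) `|d|; first by exists (x %/ d)%Z; lia.
have [dp|dn] := ltrP 0 d; [exists ((x %/ d)%Z + 1) | exists ((x %/ d)%Z - 1)];
  rewrite mulrDl; lia.
Qed.

Lemma eisenstein_eq0 (x y : int) : x ^+ 2 - x * y + y ^+ 2 = 0 -> x = 0 /\ y = 0.
Proof. nia. Qed.

Section CyclicCubicOrder.
Variables (A : comNzRingType) (e : 'I_3 -> A) (s : {rmorphism A -> A}).
Hypotheses (eb : is_Zbasis e) (domA : GRing.integral_domain_axiom A).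
Hypothesis s3 : forall z, s (s (s z)) = z.
Variable w0 : A.
Hypothesis w0_moved : s w0 <> w0.

Lemma rmorphMz z (n : int) : s (z *~ n) = s z *~ n.
Proof. exact: raddfMz. Qed.

(* For w moved by s, the elements 1, z, w, z w are dependent; comparing the
   relation with its image under s shows that z is rational. *)
Lemma fixed_int z : s z = z -> exists m : int, z = m%:~R.
Proof.
move=> sz; pose f (w : A) (i : 'I_4) := nth 1 [:: 1; z; w; z * w] i.
have [c c0 cE] := Zbasis_dependent eb (f w0).
have [k0 [k1 [k2 [k3 cK]]]] : exists k0 k1 k2 k3 : int,
    c = \row_(i < 4) nth 0 [:: k0; k1; k2; k3] i.
  exists (c 0 (inord 0)), (c 0 (inord 1)), (c 0 (inord 2)), (c 0 (inord 3)).
  by apply/rowP => -[[|[|[|[|//]]]] i4]; rewrite mxE /=; congr (c _ _);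
    apply/val_inj; rewrite /= inordK.
have fE w : Zcomb (f w) c = k0%:~R + z *~ k1 + w * (k2%:~R + z *~ k3).
  by rewrite cK /Zcomb !big_ord_recl big_ord0 !mxE /f /=; ring.
have cE' : Zcomb (f (s w0)) c = 0.
  by rewrite -(rmorph0 s) -cE !fE !(rmorphD s, rmorphM s, rmorphMz, rmorph1, rmorph_int) sz.
move: cE cE'; rewrite !fE => cE cE'.
have /domA/orP[/eqP h|/eqP h] : (w0 - s w0) * (k2%:~R + z *~ k3) = 0.
- transitivity (k0%:~R + z *~ k1 + w0 * (k2%:~R + z *~ k3)
    - (k0%:~R + z *~ k1 + s w0 * (k2%:~R + z *~ k3))); first by ring.
  by rewrite cE cE' subrr.
- by case: w0_moved; apply/esym/eqP; rewrite -subr_eq0 h.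
rewrite h mulr0 addr0 in cE.
have rat (m k : int) : k%:~R + z *~ m = 0 -> m != 0 -> exists m : int, z = m%:~R.
  move=> E m0; apply: (@Zbasis_intr _ _ _ eb z m (- k)) => //.
  by apply/eqP; rewrite -subr_eq0 -E mulrNz opprK addrC.
have [k1_0|] := eqVneq k1 0; last exact: rat cE.
have [k3_0|] := eqVneq k3 0; last exact: rat h.
have int0 (k : int) : k%:~R = 0 :> A -> k = 0.
  move=> kA; apply/eqP; apply: contrapT => /negP kn0.
  by move: (Zbasis_mulrz_eq0 eb kA kn0) => /eqP; rewrite oner_eq0.
rewrite k3_0 mulr0z addr0 in h; rewrite k1_0 mulr0z addr0 in cE.
case/negP: c0; rewrite cK (int0 _ cE) (int0 _ h) k1_0 k3_0.
by apply/eqP/rowP => -[[|[|[|[|//]]]] i4]; rewrite !mxE.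
Qed.

(** Take a relation k + x w + y s(w) = 0. Then x - y times it minus y times its image under s
    eliminates s(w) and makes (x^2 - x y + y^2) w an integer. If the factor is nonzero, w is an
    integer and hence fixed; otherwise the relation is trivial. *)
Lemma moved_det_neq0 w : s w <> w -> \det (coord_mx e (tri 1 w (s w))) != 0.
Proof.
move=> sw; apply/eqP => /(Zdet_eq0 eb) [c c0].
have [k [x [y cE]]] := row3_eta c; rewrite cE Zcomb_tri => E.
have [t tE] : exists t : int, w + s w + s (s w) = t%:~R.
  by apply: fixed_int; rewrite !rmorphD s3; ring.
have ssw : s (s w) = t%:~R - w - s w by rewrite -tE; ring.
have := congr1 s E; rewrite !rmorphD !rmorphMz rmorph1 rmorph0 ssw => E'.
have : w *~ (x ^+ 2 - x * y + y ^+ 2) = (y * (k + t * y) - k * (x - y))%:~R.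
  transitivity ((1 *~ k + w *~ x + s w *~ y) *~ (x - y)
     - (1 *~ k + s w *~ x + (t%:~R - w - s w) *~ y) *~ y
     + (y * (k + t * y) - k * (x - y))%:~R); first by ring.
  by rewrite E E'; ring.
have [/eisenstein_eq0[x0 y0] _|N0] := eqVneq (x ^+ 2 - x * y + y ^+ 2) 0.
  rewrite x0 y0 !mulr0z !addr0 in E.
  have k0 : k = 0.
    apply/eqP; apply: contrapT => /negP kn0.
    by move: (Zbasis_mulrz_eq0 eb E kn0) => /eqP; rewrite oner_eq0.
  case/negP: c0; rewrite cE k0 x0 y0; apply/eqP/rowP => -[[|[|[|//]]] i3];
  by rewrite !mxE.
move/(Zbasis_intr eb isT N0) => [m wm]; apply: sw.
by rewrite wm rmorph_int.
Qed.

(* Euclidean division by the norm form of Z[zeta_3] on A / Z: an element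
   outside the span of 1, w, s w yields one of smaller index. *)
Lemma exists_sigma_basis : exists w, is_Zbasis (tri 1 w (s w)).
Proof.
pose D w := absz (\det (coord_mx e (tri 1 w (s w)))).
suff H n (w : A) : (D w < n)%N -> s w <> w -> exists w, is_Zbasis (tri 1 w (s w)).
  exact: (H _ w0 (ltnSn _) w0_moved).
elim: n w => // n IH w; rewrite ltnS => Dn sw.
have d0 := moved_det_neq0 sw.
have [t tE] : exists t : int, w + s w + s (s w) = t%:~R.
  by apply: fixed_int; rewrite !rmorphD s3; ring.
have ssw : s (s w) = t%:~R - w - s w by rewrite -tE; ring.
set d := \det _ in d0.
have [span|] := pselect (forall z, exists k x y : int, z = 1 *~ k + w *~ x + s w *~ y).
  exists w; apply/is_Zbasis_tri; split=> // k x y E.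
  have [|? ? ?] := @row3_inj k x y 0 0 0; last by split.
  have : row3 k x y *m coord_mx e (tri 1 w (s w)) = 0.
    by rewrite -Zcoord_Zcomb // Zcomb_tri E Zcoord0.
  move=> kM; apply/eqP; have [//|kn0] := eqVneq (row3 k x y) (row3 0 0 0).
  case/negP: d0; apply/det0P; exists (row3 k x y) => //.
  apply: contra kn0 => /eqP ->; apply/eqP/rowP => -[[|[|[|//]]] i3];
  by rewrite !mxE.
move=> /existsNP[z nz].
have [c] := Zcramer eb (tri 1 w (s w)) z; rewrite -/d.
have [k [x [y ->]]] := row3_eta c; rewrite Zcomb_tri => zE.
have [m mE] := round_div x d0; have [l lE] := round_div y d0.
set r := x - m * d in mE; set q := y - l * d in lE.
pose z2 := z - w *~ m - s w *~ l.
have z2E : z2 *~ d = 1 *~ k + w *~ r + s w *~ q.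
  by rewrite /z2 /r /q !mulrzBl zE; ring.
have z2m : s z2 <> z2.
  move=> /fixed_int [j jE]; apply: nz; exists j, m, l.
  by rewrite -[1 *~ j]/(j%:~R) -jE /z2; ring.
apply: (IH z2) => //; apply: leq_trans Dn.
(* On 1, w, s w the elements d, d z2, d s(z2) have matrix G, of determinant d (r^2 - r q + q^2).
   Hence d^3 times the index of z2 is d^2 (r^2 - r q + q^2), and d^2 cancels. *)
have dd : d * \det (coord_mx e (tri 1 z2 (s z2))) = r ^+ 2 - r * q + q ^+ 2.
  apply: (mulfI d0); apply: (mulfI d0).
  pose G (i j : nat) := nth 0 (nth [::] [:: [:: d; 0; 0]; [:: k; r; q];
     [:: k + q * t; - q; r - q]] i) j.
  have : d *: coord_mx e (tri 1 z2 (s z2)) =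
     (\matrix_(i < 3, j < 3) G i j) *m coord_mx e (tri 1 w (s w)).
    rewrite -(@coord_mx_mul _ _ _ eb _ _ (tri 1 w (s w)) (fun i => tri 1 z2 (s z2) i *~ d)).
      by apply/row_matrixP => i; rewrite linearZ /= !rowK ZcoordMz.
    move=> i; have -> : row i (\matrix_(i < 3, j < 3) G i j) = row3 (G i 0%N) (G i 1%N) (G i 2%N).
      by apply/rowP => -[[|[|[|//]]] j3]; rewrite !mxE.
    rewrite Zcomb_tri; case: i => -[|[|[|//]]] i3; rewrite /tri /G /=.
    - by ring.
    - by rewrite z2E.
    - by rewrite -rmorphMz z2E !rmorphD !rmorphMz rmorph1 ssw; ring.
  move/(congr1 determinant); rewrite detZ det_mulmx det_mx33 /G /= -/d => E.
  by transitivity (d ^+ 3 * \det (coord_mx e (tri 1 z2 (s z2)))); [ring | rewrite E; ring].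
rewrite /D -/d -ltz_nat !abszE.
(* Since |r| and |q| are at most |d| / 2, the norm form is at most 3 d^2 / 4. *)
have dlt : `|d * \det (coord_mx e (tri 1 z2 (s z2)))| < `|d| * `|d|.
  have dp : 0 < `|d| by rewrite normr_gt0.
  rewrite dd; set D0 := `|d| in mE lE dp *.
  have [r1 r2] : - D0 <= 2 * r /\ 2 * r <= D0 by lia.
  have [q1 q2] : - D0 <= 2 * q /\ 2 * q <= D0 by lia.
  rewrite ger0_norm; nia.
by move: dlt; rewrite normrM ltr_pM2l // normr_gt0.
Qed.

Lemma exists_c3_basis : exists a b u v, @c3_basis A a b u v.
Proof.
have [w wb] := exists_sigma_basis.
have [t tE] : exists t : int, w + s w + s (s w) = t%:~R.
  by apply: fixed_int; rewrite !rmorphD s3; ring.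
have [/(_ (w * s w)) [n [p [q wsw]]] wfree] := (is_Zbasis_tri _ _ _).1 wb.
have [gen _] := (is_Zbasis_tri _ _ _).1 wb.
(* Translating by q removes the component of u v along v. *)
pose u := w - q%:~R; pose v := s u.
have [a aE] : exists a, a = p - q by exists (p - q).
have [b bE] : exists b, b = t - 3 * q by exists (t - 3 * q).
have [n1 n1d] : exists n1, n1 = n + p * q by exists (n + p * q).
have vE : v = s w - q%:~R by rewrite /v rmorphB rmorph_int.
have uvb : is_Zbasis (tri 1 u v).
  apply/is_Zbasis_tri; split=> [z|k x y E].
    have [k [x [y ->]]] := gen z; exists (k + q * (x + y)), x, y.
    by rewrite vE /u; ring.
  have [] := wfree (k - q * (x + y)) x y; last by move=> + x0 y0; rewrite x0 y0; split; lia.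
  by rewrite -[RHS]E vE /u; ring.
have svE : s v = b%:~R - u - v.
  have -> : s v = s (s w) - q%:~R by rewrite vE rmorphB rmorph_int.
  have -> : s (s w) = t%:~R - w - s w by rewrite -tE; ring.
  by rewrite vE /u bE; ring.
have ssv : s (s v) = u by rewrite /v s3.
have uv : u * v = n1%:~R + u *~ a.
  transitivity (w * s w - w *~ q - s w *~ q + (q ^+ 2)%:~R); first by rewrite vE /u; ring.
  by rewrite wsw /u aE n1d; ring.
(* Multiply u + v + s(v) = b by v: the product v s(v) is the image of u v under s. The next step
   uses s(v) u in the same way. *)
have vv : v * v = (- 2 * n1)%:~R - u *~ a + v *~ (b - a).
  have := congr1 s uv; rewrite (rmorphM s) -/v svE (rmorphD s) rmorph_int rmorphMz -/v => E.
  transitivity (v *~ b - u * v - v * (b%:~R - u - v)); first by ring.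
  by rewrite E uv; ring.
have uu : u * u = (- 2 * n1 - a * b)%:~R + u *~ b + v *~ a.
  have := congr1 s (congr1 s uv); rewrite !(rmorphM s) -/v ssv svE !(rmorphD s) !rmorph_int !rmorphMz -/v svE => E.
  transitivity (u *~ b - u * v - (b%:~R - u - v) * u); first by ring.
  by rewrite E uv; ring.
(* Compare the coefficients of u in (u u) v = u (u v). *)
have n1E : n1 = - a ^+ 2.
  have E : (u * u) * v = u * (u * v) by ring.
  have E1 : (u * u) * v = (b * n1 - 2 * a * n1)%:~R + u *~ (a * b - a ^+ 2)
       + v *~ (- 2 * n1 - a ^+ 2).
    transitivity (v *~ (- 2 * n1 - a * b) + (u * v) *~ b + (v * v) *~ a).
      by rewrite uu; ring.
    by rewrite uv vv; ring.
  have E2 : u * (u * v) = (- 2 * n1 * a - a ^+ 2 * b)%:~R + u *~ (n1 + a * b)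
       + v *~ a ^+ 2.
    transitivity (u *~ n1 + (u * u) *~ a); first by rewrite uv; ring.
    by rewrite uu; ring.
  by rewrite E1 E2 in E; have [_ ? _] := Zbasis_tri_free uvb E; lia.
exists a, b, u, v; split=> //; split.
- by rewrite uv n1E; ring.
- by rewrite uu n1E; ring.
- by rewrite vv n1E; ring.
Qed.

End CyclicCubicOrder.

(** Take s = [phi 1]. The map [phi 0] is idempotent and injective, hence the identity, and
    injectivity of phi separates s from it. *)
Lemma C3_order_automorphism (A : comNzRingType) :
  aut_group_isomorphic A 'Z_3 ->
  exists2 s : A -> A, is_ring_iso s & (forall z, s (s (s z)) = z) /\ exists w, s w <> w.
Proof.
move=> [phi [[phiin phiinj _] phiM]].
have id0 z : phi 0 z = z.
  have /= [_ _ [g gK _]] := phiin 0 I.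
  apply: (can_inj gK); rewrite -[LHS]/((phi 0 \o phi 0) z) -phiM.
  by congr (phi _ _); exact/val_inj.
have phi3 : phi 1 \o (phi 1 \o phi 1) = phi 0.
  by rewrite -!phiM; congr phi; exact/val_inj.
exists (phi 1); first exact: (phiin 1 I).
split=> [z|]; first by rewrite -[LHS]/((phi 1 \o (phi 1 \o phi 1)) z) phi3 id0.
apply: contrapT => /forallNP H.
suff : (1 : 'Z_3) = 0 by move/eqP.
apply: phiinj; rewrite ?in_setT //; apply: funext => z.
by rewrite id0; apply: contrapT; exact: H.
Qed.

(** Negation makes a positive, and the flip reflects b about 3 a / 2. The case a = 0 is excluded
    because it gives u v = 0 in a domain. *)
Lemma C3_order_reduced_basis (A : comNzRingType) :
  C3_cubic_order A -> exists a b u v, [/\ @c3_basis A a b u v, 0 < a & 3 * a <= 2 * b].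
Proof.
move=> [[[e eb] domA] /C3_order_automorphism [s siso [s3 [w0 w0m]]]].
have [S SE] := ring_iso_rmorph siso; rewrite -SE in s3 w0m.
have [a [b [u [v H]]]] := exists_c3_basis eb domA s3 w0m.
have flip a' b' u' v' : @c3_basis A a' b' u' v' -> 0 < a' ->
    exists a b u v, [/\ @c3_basis A a b u v, 0 < a & 3 * a <= 2 * b].
  move=> H' a0; have [h|h] := lerP (3 * a') (2 * b').
    by exists a', b', u', v'.
  exists a', (3 * a' - b'), (a'%:~R - u'), (a'%:~R - b'%:~R + u' + v').
  by split; [exact: c3_basis_flip | | lia].
have [a0|a0|a0] := ltrgtP a 0.
- by apply: (flip _ _ _ _ (c3_basisN H)); lia.
- exact: flip H a0.
have [bb [uv _ _]] := H; rewrite a0 mulr0z expr0n /= subr0 in uv.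
have free := Zbasis_tri_free bb.
have /domA/orP[/eqP uE|/eqP vE] := uv.
- by have [|_ + _] := free 0 1 0 0 0 0; [rewrite uE; ring|].
- by have [|_ _ +] := free 0 0 1 0 0 0; [rewrite vE; ring|].
Qed.

(** * Automorphisms and isomorphisms *)

Lemma rmorph_cubic (A B : comNzRingType) (F : {rmorphism A -> B}) (z : A) (k l m : int) :
  F (z ^+ 3 - z ^+ 2 *~ k + z *~ l + m%:~R)
    = F z ^+ 3 - F z ^+ 2 *~ k + F z *~ l + m%:~R.
Proof.
have FX n : F (z ^+ n) = F z ^+ n by exact: rmorphXn.
have FM x (n : int) : F (x *~ n) = F x *~ n by exact: raddfMz.
by rewrite !rmorphD rmorphN !FM !FX rmorph1.
Qed.

(* u^2 = (2 a^2 - a b) + b u + a v: the image of u determines that of v. *)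
Lemma c3_basis_rmorph_eq (A B : comNzRingType) (a b : int) (u v : A)
    (F G : {rmorphism A -> B}) :
  c3_basis a b u v -> a != 0 ->
  (forall (x : B) (m : int), x *~ m = 0 -> m != 0 -> x = 0) ->
  F u = G u -> F = G :> (A -> B).
Proof.
move=> uvb a0 torsion FG; have [_ [_ uu _]] := uvb.
have HM (H : {rmorphism A -> B}) x n : H (x *~ n) = H x *~ n by exact: raddfMz.
have HvE (H : {rmorphism A -> B}) :
    H v *~ a = H u * H u - (2 * a ^+ 2 - a * b)%:~R - H u *~ b.
  rewrite -HM (_ : v *~ a = u * u - (2 * a ^+ 2 - a * b)%:~R - u *~ b).
    by rewrite !(rmorphB H) (rmorphM H) !HM rmorph1.
  by rewrite uu; ring.
have FG' : F v = G v.
  apply/eqP; rewrite -subr_eq0; apply/eqP; apply: (torsion _ a) => //.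
  by rewrite mulrzBl !HvE FG subrr.
apply: funext => z; have [k [x [y ->]]] := c3_basis_gen uvb z.
by rewrite !(rmorphD F) !(rmorphD G) !HM !rmorph1 FG FG'.
Qed.

Section C3Aut.
Variables a b : int.
Local Notation T := (c3ring a b).
Local Notation s := (@c3_sigma a b).
Local Notation t := (c3_t a b).
Hypothesis domT : GRing.integral_domain_axiom T.

Lemma c3_sigma_t : s t = c3_t' a b.
Proof. by apply: c3_eq => /=; ring. Qed.

Lemma c3_sigma2_iso : is_ring_iso (s \o s).
Proof. by apply: ring_iso_comp; exact: c3_sigma_iso. Qed.

(** The characteristic polynomial of t has integer coefficients and splits as (z - t)(z - s t)(z -
    s^2 t). In a domain F t is therefore one of the three conjugates of t, and the image of t
    determines F. *)
Lemma c3_aut (f : T -> T) : is_ring_iso f ->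
  [\/ f = id, f = s | f = s \o s].
Proof.
move=> /ring_iso_rmorph [F <-].
have a0 := c3_domain_a_neq0 domT.
have root (z : T) : (z - t) * (z - s t) * (z - s (s t)) =
   z ^+ 3 - z ^+ 2 *~ b + z *~ (a * b - 3 * a ^+ 2)
     + (a ^+ 3)%:~R.
  have e1 : t + s t + s (s t) = b%:~R by rewrite c3_trace; congr _%:~R => /=; ring.
  have e2 : t * s t + s t * s (s t) + s (s t) * t = (a * b - 3 * a ^+ 2)%:~R.
    by rewrite c3_intr; apply: c3_eq => /=; ring.
  have e3 : t * s t * s (s t) = (- a ^+ 3)%:~R.
    by rewrite c3_intr; apply: c3_eq => /=; ring.
  transitivity (z ^+ 3 - z ^+ 2 * (t + s t + s (s t))
    + z * (t * s t + s t * s (s t) + s (s t) * t) - t * s t * s (s t)); first by ring.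
  by rewrite e1 e2 e3 !mulrzr mulrNz opprK.
have Ft0 : (F t - t) * (F t - s t) * (F t - s (s t)) = 0.
  by rewrite root -rmorph_cubic -root subrr !mul0r rmorph0.
have ext (G : T -> T) : is_ring_iso G -> F t = G t -> F = G :> (T -> T).
  move=> /ring_iso_rmorph [{}G <-].
  apply: (c3_basis_rmorph_eq (c3ring_basis a b) a0).
  by move=> x m; exact: c3_mulrz_eq0.
move/domT: Ft0 => /orP[/eqP/domT/orP[]|]; rewrite subr_eq0 => /eqP E.
- by constructor 1; apply: ext => //; split=> //; exists id.
- by constructor 2; apply: ext => //; exact: c3_sigma_iso.
- by constructor 3; apply: ext => //; exact: c3_sigma2_iso.
Qed.

Lemma c3ring_C3_order : C3_cubic_order T.
Proof.
split.
  by split=> //; have [? _] := c3ring_basis a b; exists (tri 1 t (c3_t' a b)).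
exists (fun i : 'Z_3 => iter i s); split; last first.
  move=> [[|[|[|//]]] i3] [[|[|[|//]]] j3]; apply: funext => z //=;
  by rewrite ?c3_sigma3.
split.
- move=> [[|[|[|//]]] i3] _ /=.
  + by split=> //; exists id.
  + exact: c3_sigma_iso.
  + exact: c3_sigma2_iso.
(* The three powers of s already differ at t, which they send to t, t' and b - t - t'. *)
- move=> [[|[|[|//]]] i3] [[|[|[|//]]] j3] _ _ /= /(congr1 (fun f => f t)) //= E;
  by apply: val_inj => //=; move: E; case; lia.
- move=> f /c3_aut [->|->|->]; [exists 0|exists 1|exists 2%:R] => //.
Qed.

End C3Aut.

(** Modulo Z, u is x + y zeta_3 times t, and generating the quotient forces this factor to be one of
    the six units of Z[zeta_3]. Each of them leaves (a, b) fixed or negates it. *)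
Lemma c3_basis_sigma (a b a' b' : int) (u : c3ring a b) :
  c3_basis a' b' u (c3_sigma u) -> (a' = a /\ b' = b) \/ (a' = - a /\ b' = - b).
Proof.
case: u => k x y [/is_Zbasis_tri[gen _] [uv uu _]].
have N1 : x ^+ 2 - x * y + y ^+ 2 = 1.
  have [l [z [w]]] := gen (c3_t a b).
  rewrite c3_intr !c3_intmul !c3_addE => -[_ E1 E2].
  (* Multiplicativity of the norm, applied to (z + w zeta_3)(x + y zeta_3) = 1. *)
  have : (x ^+ 2 - x * y + y ^+ 2) * (z ^+ 2 - z * w + w ^+ 2) = 1.
    transitivity ((z * x - w * y) ^+ 2 - (z * x - w * y) * (z * y + w * (x - y))
      + (z * y + w * (x - y)) ^+ 2); first by ring.
    have -> : z * x - w * y = 1 by rewrite E1; ring.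
    have -> : z * y + w * (x - y) = 0 by rewrite E2; ring.
    by ring.
  move/int_unit_sqr; nia.
move: uv uu; rewrite !c3_intr !c3_intmul !c3_oppE !c3_addE !c3_mulE /=.
move=> [_ v1 v2] [_ u1 u2].
have [y1 y2] : -1 <= y /\ y <= 1 by nia.
have [x1 x2] : -1 <= x /\ x <= 1 by nia.
have /orP[/orP[] /eqP xE|/eqP xE] : (x == -1) || (x == 0) || (x == 1) by lia.
all: have /orP[/orP[] /eqP yE|/eqP yE] : (y == -1) || (y == 0) || (y == 1) by lia.
all: rewrite xE yE in N1 u1 u2 v1 v2.
all: lia.
Qed.

Lemma c3_basis_iso_image (A B : comNzRingType) (a b : int) (u v : A)
    (f : {rmorphism A -> B}) :
  bijective f -> c3_basis a b u v -> c3_basis a b (f u) (f v).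
Proof.
move=> [g fK gK] [/is_Zbasis_tri[gen free] [uv uu vv]].
have fM x n : f (x *~ n) = f x *~ n by exact: raddfMz.
split; last first.
  rewrite -!(rmorphM f) uv uu vv.
  by rewrite !(rmorphD f) !(rmorphN f) !fM rmorph1.
have fE k x y : f (1 *~ k + u *~ x + v *~ y) = 1 *~ k + f u *~ x + f v *~ y.
  by rewrite !(rmorphD f) !fM rmorph1.
apply/is_Zbasis_tri; split=> [z|k x y E].
  have [k [x [y E]]] := gen (g z); exists k, x, y.
  by rewrite -fE -E gK.
by apply: free; apply: (can_inj fK); rewrite fE E rmorph0.
Qed.

(** The transported automorphism h is a power of sigma. It is not the identity since u and v differ;
    if it is sigma, [c3_basis_sigma] applies directly, and if it is sigma^2, it applies after a
    flip. The inequalities then leave only equality. *)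
Lemma c3ring_iso_reduced (a b a' b' : int) :
  GRing.integral_domain_axiom (c3ring a b) ->
  0 < a -> 3 * a <= 2 * b -> 0 < a' -> 3 * a' <= 2 * b' ->
  ring_isomorphic (c3ring a' b') (c3ring a b) -> a' = a /\ b' = b.
Proof.
move=> domT a0 ab a0' ab' [f fiso].
have [F FE] := ring_iso_rmorph fiso; have [_ _ Fbij] := fiso.
rewrite -FE in Fbij.
have Fb := c3_basis_iso_image Fbij (c3ring_basis a' b').
have [g gK Kg] := Fbij.
pose h := F \o (@c3_sigma a' b' \o g).
have hiso : is_ring_iso h.
  have Fiso : is_ring_iso F by rewrite FE.
  apply: ring_iso_comp; last exact: Fiso.
  by apply: ring_iso_comp; [exact: ring_iso_inv Fiso gK Kg | exact: c3_sigma_iso].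
set u := F (c3_t a' b') in Fb; set v := F (c3_t' a' b') in Fb.
have hu : h u = v by rewrite /h /u /= gK c3_sigma_t.
have huv : u + v + h v = b'%:~R.
  rewrite /h /u /v /= gK -c3_sigma_t -!rmorphD c3_trace -(rmorph_int F); congr (F _%:~R).
  by rewrite /=; ring.
have [hE|hE|hE] := c3_aut domT hiso.
- have := Zbasis_tri_free (k := 0) (x := 1) (y := 0) (l := 0) (z := 0) (w := 1) Fb.1.
  by rewrite -hu hE => -[|_]; first by ring.
- rewrite -hu hE in Fb; have := c3_basis_sigma Fb; lia.
have := c3_basis_flip Fb.
have -> : a'%:~R - b'%:~R + u + v = c3_sigma (a'%:~R - u).
  have [sB _ _] := @c3_sigma_iso a b; rewrite sB.
  have -> : c3_sigma a'%:~R = a'%:~R :> c3ring a b.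
    by rewrite c3_intr; apply: c3_eq => /=; ring.
  have -> : c3_sigma u = h v by rewrite -hu hE /= c3_sigma3.
  by rewrite -huv; ring.
by move/c3_basis_sigma; lia.
Qed.

(** * Pairs (a, b) whose ring is not a domain *)

(* The index form a x^3 - b x^2 y + (b - 3 a) x y^2 + a y^3 vanishes at (x, y) iff
   (a : b) = (x y (x - y) : x^3 - 3 x y^2 + y^3), and for coprime x, y these two
   values are coprime. *)
Lemma c3_reducible_param (a b x y : int) :
  a != 0 -> (x != 0) || (y != 0) ->
  a * (x ^+ 3 - 3 * x * y ^+ 2 + y ^+ 3) = b * (x * y * (x - y)) ->
  exists k z w : int, [/\ 0 < k, z != 0, w != 0, a = k * (z * w * (z - w)) &
    b = k * (z ^+ 3 - 3 * z * w ^+ 2 + w ^+ 3)].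
Proof.
move=> a0 xy0 E.
have g0 : gcdz x y != 0 by rewrite gcdz_eq0 negb_and.
pose g := gcdz x y; pose z := (x %/ g)%Z; pose w := (y %/ g)%Z.
have xE : x = z * g by rewrite divzK // dvdz_gcdl.
have yE : y = w * g by rewrite divzK // dvdz_gcdr.
have cop : coprimez z w.
  have gg : `|g|%N = g :> int by rewrite /g /gcdz absz_nat.
  by apply/eqP/(mulIf g0); rewrite mul1r -/g -{1}gg mulz_gcdl -xE -yE.
have E' : a * (z ^+ 3 - 3 * z * w ^+ 2 + w ^+ 3) = b * (z * w * (z - w)).
  apply: (mulIf (expf_neq0 3 g0)); rewrite -/g.
  transitivity (a * (x ^+ 3 - 3 * x * y ^+ 2 + y ^+ 3)); first by rewrite xE yE; ring.
  by rewrite E xE yE; ring.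
have cop2 : coprimez (z * w * (z - w)) (z ^+ 3 - 3 * z * w ^+ 2 + w ^+ 3).
  have cop3 : coprimez w (z - w).
    by rewrite /coprimez -[z - w]addrC -mulN1r gcdzMDl gcdzC.
  (* Modulo z, w and z - w the cubic form is w^3, z^3 and (- w)^3. *)
  rewrite !coprimezMl; apply/andP; split; first (apply/andP; split).
  - rewrite /coprimez [X in gcdz _ X](_ : _ = (z ^+ 2 - 3 * w ^+ 2) * z + w ^+ 3); last by ring.
    by rewrite gcdzMDl -/(coprimez _ _) coprimezXr.
  - rewrite /coprimez [X in gcdz _ X](_ : _ = (w ^+ 2 - 3 * z * w) * w + z ^+ 3); last by ring.
    by rewrite gcdzMDl -/(coprimez _ _) coprimezXr // coprimez_sym.
  - rewrite /coprimez [X in gcdz _ X](_ : _ =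
      (z ^+ 2 + z * w - 2 * w ^+ 2) * (z - w) + (- w) ^+ 3); last by ring.
    by rewrite gcdzMDl -/(coprimez _ _) coprimezXr // coprimezN coprimez_sym.
have /dvdzP[k kE] : (z * w * (z - w) %| a)%Z.
  by rewrite -(Gauss_dvdzl _ cop2) E' dvdz_mull.
have zw0 : z * w * (z - w) != 0 by apply: contraNneq a0 => zw0; rewrite kE zw0 mulr0.
have k0 : k != 0 by apply: contraNneq a0 => k0; rewrite kE k0 mul0r.
have bE : b = k * (z ^+ 3 - 3 * z * w ^+ 2 + w ^+ 3).
  by apply: (mulIf zw0); rewrite -E' kE; ring.
have /andP[z0 w0] : (z != 0) && (w != 0).
  by move: zw0; rewrite !mulf_eq0 !negb_or => /andP[].
have [kp|kn] := ltrP 0 k; first by exists k, z, w.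
(* Both forms are of odd degree, so the sign of k moves into z and w. *)
exists (- k), (- z), (- w); rewrite !oppr_eq0 kE bE; split=> //; [by lia | ring | ring].
Qed.

Lemma c3_reducible_disc (k z w : int) :
  let a := k * (z * w * (z - w)) in
  let b := k * (z ^+ 3 - 3 * z * w ^+ 2 + w ^+ 3) in
  b ^+ 2 - 3 * a * b + 9 * a ^+ 2 = k ^+ 2 * (z ^+ 2 - z * w + w ^+ 2) ^+ 3.
Proof. by move=> a b; rewrite /a /b; ring. Qed.

Lemma normM_le_eisenstein (z w : int) : `|z| * `|w| <= z ^+ 2 - z * w + w ^+ 2.
Proof.
have h1 := sqr_ge0 (z - w); have h2 := sqr_ge0 z; have h3 := sqr_ge0 w.
rewrite sqrrB in h1; rewrite -normrM ler_norml; apply/andP; split; lia.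
Qed.

(** Replacing the norm form by its lower bound |z| |w| separates the variables for the count. *)
Lemma c3_not_domain_param (a b : int) :
  a != 0 -> ~ GRing.integral_domain_axiom (c3ring a b) ->
  exists (k z w : int), [/\ 0 < k, z != 0, w != 0,
     a = k * (z * w * (z - w)) /\ b = k * (z ^+ 3 - 3 * z * w ^+ 2 + w ^+ 3)
   & k ^+ 2 * (`|z| * `|w|) ^+ 3 <= b ^+ 2 - 3 * a * b + 9 * a ^+ 2].
Proof.
move=> a0 /c3_not_domain [x [y [xy0 E]]].
have [k [z [w [k0 z0 w0 aE bE]]]] := c3_reducible_param a0 xy0 E.
exists k, z, w; split=> //; rewrite aE bE c3_reducible_disc.
rewrite ler_pM2l ?exprn_gt0 //; apply: lerXn2r; rewrite ?nnegrE.
- by rewrite mulr_ge0.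
- by apply: le_trans (normM_le_eisenstein z w); rewrite mulr_ge0.
- exact: normM_le_eisenstein.
Qed.

(** * Lattice points *)

Section QuarterDisc.
Variable R : realType.
Implicit Types (x y : R).

(** Twice the area of the part of the unit quarter disc over [0, sin x], for x in [0, pi / 2]. *)
Definition sector x : R := x + sin x * cos x.

Lemma is_derive_sector x : is_derive x 1 sector (2 * cos x ^+ 2).
Proof.
rewrite /sector; apply: is_derive_eq.
rewrite /GRing.scale /= mulrN -!expr2 sin2cos2; ring.
Qed.

Lemma nondecreasing_of_derive (f df : R -> R) (a b : R) :
  (forall x, is_derive x 1 f (df x)) ->
  (forall x, a < x < b -> 0 <= df x) -> a <= b -> f a <= f b.
Proof.
move=> fD df0 ab.
apply: (@ger0_derive1_ndecr R f a b) => //.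
- by move=> x; rewrite in_itv /= => /df0; rewrite derive1E derive_val.
- apply: continuous_subspaceT => x; apply/differentiable_continuous.
  exact/derivable1_diffP.
Qed.

Lemma pihalf_sin_cos_ge0 x : 0 <= x -> x <= pi / 2 -> 0 <= sin x /\ 0 <= cos x.
Proof.
move=> x0 xpi; have p0 := pi_ge0 R; split.
  by apply: sin_ge0_pi; rewrite x0 /=; lra.
by apply: cos_ge0_pihalf; rewrite xpi andbT; lra.
Qed.

Lemma pihalf_sin_le x y : 0 <= x -> x <= y -> y <= pi / 2 -> sin x <= sin y.
Proof.
move=> x0 xy ypi; apply: (@nondecreasing_of_derive sin cos x y) => // z /andP[xz zy].
by have [] := @pihalf_sin_cos_ge0 z ltac:(lra) ltac:(lra).
Qed.

Lemma pihalf_cos_le x y : 0 <= x -> x <= y -> y <= pi / 2 -> cos y <= cos x.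
Proof.
move=> x0 xy ypi; rewrite -lerN2.
apply: (@nondecreasing_of_derive (fun z => - cos z) sin x y) => //.
  by move=> z; apply: is_derive_eq; rewrite opprK.
move=> z /andP[xz zy].
by have [] := @pihalf_sin_cos_ge0 z ltac:(lra) ltac:(lra).
Qed.

(** On [a, b] the cosine decreases, so the derivative 2 cos^2 is at most 2 cos a times the
    derivative of sin. *)
Lemma sector_le (a b : R) : 0 <= a -> a <= b -> b <= pi / 2 ->
  sector b - sector a <= 2 * cos a * (sin b - sin a).
Proof.
move=> a0 ab bpi.
have D x : is_derive x 1 (fun z => 2 * cos a * sin z - sector z)
    (2 * cos x * (cos a - cos x)).
  have := is_derive_sector x => Ds.
  apply: is_derive_eq; rewrite /GRing.scale /=; ring.
have := @nondecreasing_of_derive _ _ a b D; rewrite ab => H.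
suff : 2 * cos a * sin a - sector a <= 2 * cos a * sin b - sector b by lra.
apply: H => // x /andP[ax xb].
have [_ cx] := @pihalf_sin_cos_ge0 x ltac:(lra) ltac:(lra).
have := @pihalf_cos_le a x a0 ltac:(lra) ltac:(lra) => cc.
by rewrite mulr_ge0 ?mulr_ge0 ?subr_ge0.
Qed.

(** The rectangle is given the moving height cos z: the excess of the sector over it vanishes at a
    and has derivative 2 sin z (sin z - sin a). *)
Lemma sector_ge (a b : R) : 0 <= a -> a <= b -> b <= pi / 2 ->
  2 * cos b * (sin b - sin a) <= sector b - sector a.
Proof.
move=> a0 ab bpi.
have D x : is_derive x 1 (fun z => sector z - 2 * (cos z * (sin z - sin a)))
    (2 * sin x * (sin x - sin a)).
  have := is_derive_sector x => Ds.
  apply: is_derive_eq; rewrite /GRing.scale /=; ring.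
have := @nondecreasing_of_derive _ _ a b D; rewrite ab => H.
suff : sector a - 2 * (cos a * (sin a - sin a)) <= sector b - 2 * (cos b * (sin b - sin a)).
  by rewrite subrr mulr0; lra.
apply: H => // x /andP[ax xb].
have [sx _] := @pihalf_sin_cos_ge0 x ltac:(lra) ltac:(lra).
have := @pihalf_sin_le a x a0 ltac:(lra) ltac:(lra) => cc.
by rewrite mulr_ge0 ?mulr_ge0 ?subr_ge0.
Qed.

Variable r : R.
Hypothesis r0 : 0 < r.

(* The area of the part of the quarter disc of radius r over [0, x]. *)
Definition disc_area x : R := r ^+ 2 / 2 * sector (asin (x / r)).

Lemma disc_area0 : disc_area 0 = 0.
Proof.
have p0 := pi_ge0 R.
have -> : disc_area 0 = r ^+ 2 / 2 * sector (asin (sin 0)) by rewrite sin0 /disc_area mul0r.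
rewrite sinK ?in_itv /= /sector ?sin0 ?mul0r ?addr0 ?mulr0 //; lra.
Qed.

Lemma disc_area_r : disc_area r = pi / 4 * r ^+ 2.
Proof.
have p0 := pi_ge0 R.
have -> : disc_area r = r ^+ 2 / 2 * sector (asin (sin (pi / 2))).
  by rewrite sin_pihalf /disc_area divff ?gt_eqF.
rewrite sinK ?in_itv /= /sector ?cos_pihalf ?mulr0 ?addr0; first by field.
by lra.
Qed.

Lemma asin_pihalf x : 0 <= x <= 1 -> 0 <= asin x /\ asin x <= pi / 2.
Proof.
move=> x01; have x11 : -1 <= x <= 1 by lra.
split; last exact: asin_lepi2.
rewrite leNgt; apply/negP => an.
have p0 := pi_ge0 R.
have : sin (- asin x) <= 0 by rewrite sinN asinK ?in_itv //=; lra.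
apply/negP; rewrite -ltNge; apply: sin_gt0_pi.
by have := asin_geNpi2 x11; have := pi_gt0 R; lra.
Qed.

Lemma asin_le_pihalf x y : 0 <= x -> x <= y -> y <= 1 -> asin x <= asin y.
Proof.
move=> x0 xy y1; rewrite leNgt; apply/negP => lt.
have [ax apx] := asin_pihalf (x := x) ltac:(lra).
have [ay apy] := asin_pihalf (x := y) ltac:(lra).
have := pihalf_sin_le ay (ltW lt) apx; rewrite !asinK ?in_itv /=; try lra.
move=> yx; have E : x = y by lra.
by rewrite E ltxx in lt.
Qed.

(** A vertical strip lies between the rectangles with the heights of its two ends; x = r sin theta
    reduces this to [sector_ge] and [sector_le]. *)
Lemma disc_area_bounds x y : 0 <= x -> x <= y -> y <= r ->
  Num.sqrt (r ^+ 2 - y ^+ 2) * (y - x) <= disc_area y - disc_area x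
   <= Num.sqrt (r ^+ 2 - x ^+ 2) * (y - x).
Proof.
move=> x0 xy yr.
have sq z : 0 <= z <= r -> Num.sqrt (r ^+ 2 - z ^+ 2) = r * cos (asin (z / r)).
  move=> /andP[z0 zr]; rewrite cos_asin; last first.
    by rewrite ler_pdivrMr // ler_pdivlMr //; lra.
  rewrite -{2}(gtr0_norm r0) -sqrtr_sqr -sqrtrM ?sqr_ge0 //.
  by congr Num.sqrt; field; rewrite gt_eqF.
have sn z : 0 <= z <= r -> z = r * sin (asin (z / r)).
  move=> /andP[z0 zr]; rewrite asinK ?in_itv /=; first by field; rewrite gt_eqF.
  by rewrite ler_pdivrMr // ler_pdivlMr //; lra.
have xr : 0 <= x <= r by rewrite x0 (le_trans xy).
have yr' : 0 <= y <= r by rewrite (le_trans x0).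
have D : y - x = r * (sin (asin (y / r)) - sin (asin (x / r))).
  by rewrite mulrBr -!sn.
rewrite D (sq _ xr) (sq _ yr').
have xr0 : 0 <= x / r by rewrite divr_ge0 // ltW.
have xyr : x / r <= y / r by rewrite ler_pM2r ?invr_gt0.
have yr1 : y / r <= 1 by rewrite ler_pdivrMr // mul1r.
have [ax _] := asin_pihalf (x := x / r) ltac:(lra).
have [_ ay] := asin_pihalf (x := y / r) ltac:(lra).
have axy := asin_le_pihalf xr0 xyr yr1.
have h1 := sector_le ax axy ay; have h2 := sector_ge ax axy ay.
rewrite /disc_area; have r2 : 0 < r ^+ 2 / 2 by rewrite divr_gt0 ?exprn_gt0.
rewrite -(ler_pM2l r2) in h1; rewrite -(ler_pM2l r2) in h2.
rewrite -mulrBr; apply/andP; split.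
  by apply: le_trans h2; rewrite le_eqVlt; apply/orP; left; apply/eqP; field.
by apply: le_trans h1 _; rewrite le_eqVlt; apply/orP; left; apply/eqP; field.
Qed.

(** With unit steps, right-end heights bound the area from below and left-end heights from above;
    the two sums differ by the height r at 0. *)
Lemma quarter_disc_sum :
  pi / 4 * r ^+ 2 - r <= \sum_(1 <= i < (Num.truncn r).+1) Num.sqrt (r ^+ 2 - i%:R ^+ 2)
    <= pi / 4 * r ^+ 2.
Proof.
set n := Num.truncn r; set g := fun i : nat => Num.sqrt (r ^+ 2 - i%:R ^+ 2).
have nr : n%:R <= r by rewrite truncn_le ltW.
have rn : r < n.+1%:R by have /andP[] := truncn_itv (ltW r0).
have up m : (m <= n)%N -> \sum_(1 <= i < m.+1) g i <= disc_area m%:R.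
  elim: m => [|m IH] mn; first by rewrite big_geq // disc_area0.
  rewrite big_nat_recr //=; have := IH (ltnW mn).
  have mr : m.+1%:R <= r by apply: le_trans nr; rewrite ler_nat.
  have := @disc_area_bounds m%:R m.+1%:R (ler0n _ _) _ mr.
  rewrite ler_nat leqnSn => /(_ isT) /andP[+ _].
  by rewrite -/(g m.+1) -[m.+1%:R]natr1 addrAC subrr add0r mulr1; lra.
have lo m : (m <= n)%N -> disc_area m%:R <= \sum_(0 <= i < m) g i.
  elim: m => [|m IH] mn; first by rewrite big_geq // disc_area0.
  rewrite big_nat_recr //=; have := IH (ltnW mn).
  have mr : m.+1%:R <= r by apply: le_trans nr; rewrite ler_nat.
  have := @disc_area_bounds m%:R m.+1%:R (ler0n _ _) _ mr.
  rewrite ler_nat leqnSn => /(_ isT) /andP[_ +].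
  by rewrite -/(g m) -[m.+1%:R]natr1 addrAC subrr add0r mulr1; lra.
have /andP[b1 b2] := @disc_area_bounds n%:R r (ler0n _ _) nr (lexx r).
rewrite -disc_area_r; apply/andP; split; last first.
  apply: le_trans (up n (leqnn n)) _; rewrite subrr sqrtr0 mul0r in b1; lra.
(* The last strip, over [n, r], has width less than 1. *)
have gn : Num.sqrt (r ^+ 2 - n%:R ^+ 2) * (r - n%:R) <= g n.
  rewrite -[leRHS]mulr1; apply: ler_wpM2l; first exact: sqrtr_ge0.
  by move: rn; rewrite -natr1; lra.
have : \sum_(0 <= i < n.+1) g i = r + \sum_(1 <= i < n.+1) g i.
  by rewrite big_nat_recl // big_add1 /= /g expr0n subr0 sqrtr_sqr gtr0_norm.
rewrite big_nat_recr //=; have := lo n (leqnn n); rewrite /g in gn *; lra.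
Qed.

End QuarterDisc.

(** * Counting reduced pairs row by row *)

Section Counting.
Variable R : realType.

Lemma count_lt_nat (v : R) (m : nat) : 0 <= v -> v <= m%:R ->
  v <= \sum_(0 <= i < m) (i%:R < v :> R)%:R < v + 1.
Proof.
move=> v0 vm.
(* Without v <= m the sum is the minimum of m and the ceiling of v; these bounds are what the
   induction on m carries. *)
suff : [/\ \sum_(0 <= i < m) (i%:R < v :> R)%:R <= m%:R :> R,
    \sum_(0 <= i < m) (i%:R < v :> R)%:R < v + 1 :> R &
    v <= \sum_(0 <= i < m) (i%:R < v :> R)%:R
    \/ \sum_(0 <= i < m) (i%:R < v :> R)%:R = m%:R :> R].
  by case=> _ -> [->//|->]; rewrite vm.
elim: m {vm} => [|m [IH1 IH2 IH3]].
  by rewrite big_geq //; split; [lra | lra | right].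
rewrite big_nat_recr //=; set S := \sum_(0 <= i < m) _ in IH1 IH2 IH3 *.
rewrite -natr1; have [mv|vm] := ltrP (m%:R : R) v => /=.
  have SE : S = m%:R by case: IH3 => // ?; lra.
  by rewrite SE; split; [lra | lra | right].
by rewrite addr0; split; [lra | lra | left; case: IH3 => [|->]].
Qed.

Lemma count_itv_nat (u v : R) (m : nat) : 0 <= u -> u <= v -> v <= m%:R ->
  `|\sum_(0 <= i < m) (u <= (i%:R : R) < v)%R%:R - (v - u)| <= 1.
Proof.
move=> u0 uv vm.
have /andP[h1 h2] := count_lt_nat (le_trans u0 uv) vm.
have /andP[h3 h4] := count_lt_nat u0 (le_trans uv vm).
have E : \sum_(0 <= i < m) (u <= (i%:R : R) < v)%R%:R =
    \sum_(0 <= i < m) (i%:R < v :> R)%:R - \sum_(0 <= i < m) (i%:R < u :> R)%:R :> R.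
  rewrite -sumrB; apply: eq_bigr => i _.
  have [iu|ui] := ltrP (i%:R : R) u; first by rewrite (lt_le_trans iu uv) subrr.
  by rewrite subr0.
by rewrite E ler_norml; apply/andP; split; lra.
Qed.

(** Leaving out i = 0 saves the error term 1, so that small v contributes little when these bounds
    are summed. *)
Lemma count_pos_lt_nat (v : R) (m : nat) : 0 <= v ->
  \sum_(0 <= i < m) ((0 < i)%N && (i%:R < v :> R))%:R <= v.
Proof.
move=> v0.
suff : \sum_(0 <= i < m) ((0 < i)%N && (i%:R < v :> R))%:R <= v /\
       \sum_(0 <= i < m) ((0 < i)%N && (i%:R < v :> R))%:R <= m.-1%:R :> R by case.
elim: m => [|m [IH1 IH2]]; first by rewrite big_geq.
rewrite big_nat_recr //=; case: m IH1 IH2 => [|m] IH1 IH2.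
  by rewrite big_geq //= addr0.
have mE : m.+1%:R = m%:R + 1 :> R by rewrite natr1.
rewrite mE /= in IH2 *; have [mv|vm] := ltrP (m%:R + 1 : R) v => /=; split; lra.
Qed.

(** This is n^(-3/2), with value 0 at n = 0 because the inverse of 0 is 0. *)
Definition inv32 (n : nat) : R := (n%:R * Num.sqrt n%:R)^-1.

Lemma inv32_ge0 n : 0 <= inv32 n.
Proof. by rewrite invr_ge0 mulr_ge0 // sqrtr_ge0. Qed.

(** The sharper bound 3 - 2 / sqrt (k + 1) is inductive, since n^(-3/2) <= 2 / sqrt (n - 1) - 2 /
    sqrt n telescopes. *)
Lemma sum_inv32 m : \sum_(0 <= n < m) inv32 n <= 3.
Proof.
suff H k : \sum_(0 <= n < k.+2) inv32 n <= 3 - 2 / Num.sqrt k.+1%:R.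
  case: m => [|m]; first by rewrite big_geq.
  apply: (@le_trans _ _ (\sum_(0 <= n < m.+2) inv32 n)).
    by rewrite [leRHS]big_nat_recr //= lerDl inv32_ge0.
  by apply: le_trans (H m) _; rewrite gerBl divr_ge0 // sqrtr_ge0.
elim: k => [|k IH].
  by rewrite 2?big_nat_recr // big_geq //= /inv32 mul0r invr0 sqrtr1 mul1r invr1; lra.
rewrite big_nat_recr //=; apply: le_trans (lerD IH (lexx _)) _.
rewrite /inv32; set p := Num.sqrt k.+1%:R; set q := Num.sqrt k.+2%:R.
have p0 : 0 < p by rewrite sqrtr_gt0.
have q0 : 0 < q by rewrite sqrtr_gt0.
have qE : k.+2%:R = q ^+ 2 by rewrite sqr_sqrtr.
have pE : q ^+ 2 = p ^+ 2 + 1 by rewrite !sqr_sqrtr // natr1.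
rewrite qE.
have -> : 3 - 2 / p + (q ^+ 2 * q)^-1 =
   3 - 2 / q - (2 * (q - p) * q ^+ 2 - p) / (p * q ^+ 3) by field; lra.
rewrite gerBl divr_ge0 //; last by rewrite mulr_ge0 ?exprn_ge0 // ltW.
have pq : p <= q by rewrite ler_wsqrtr // ler_nat.
have qp : (q - p) * (q + p) = 1 by rewrite -subr_sqr pE; ring.
have s0 : 0 < q + p by lra.
rewrite -(ler_pM2r s0) mul0r.
have -> : (2 * (q - p) * q ^+ 2 - p) * (q + p) = 2 * q ^+ 2 * ((q - p) * (q + p)) - p * (q + p).
  by ring.
by rewrite qp; nra.
Qed.

Lemma card_setE (T : finType) (P : pred T) :
  #|[set p : T | P p]%SET|%:R = \sum_p (P p)%:R :> R.
Proof.
rewrite -sum1dep_card natr_sum big_mkcond /=.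
by apply: eq_bigr => p _; case: (P p).
Qed.

Definition c3_qform (i j : nat) : R := j%:R ^+ 2 - 3 * i%:R * j%:R + 9 * i%:R ^+ 2.

Definition c3_reduced (Y : R) (i j : nat) : bool :=
  [&& (0 < i)%N, (3 * i <= 2 * j)%N & c3_qform i j < Y].

Lemma c3_qformE i j : 4 * c3_qform i j = (2 * j%:R - 3 * i%:R) ^+ 2 + 27 * i%:R ^+ 2.
Proof. by rewrite /c3_qform; ring. Qed.

(** Completing the square turns row i into the integers of [3 i / 2, 3 i / 2 + h / 2) with h^2 = 4 Y
    - 27 i^2; the bound on m makes the whole interval fit. *)
Lemma sum_c3_reduced_row (Y : R) (i m : nat) : 0 < Y -> 2 * Y < m%:R ->
  (0 < i)%N -> 27 * i%:R ^+ 2 <= 4 * Y ->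
  `|\sum_(0 <= j < m) (c3_reduced Y i j)%:R - Num.sqrt (4 * Y - 27 * i%:R ^+ 2) / 2| <= 1.
Proof.
move=> Y0 Ym i0 iY; set h := Num.sqrt _.
have h0 : 0 <= h by exact: sqrtr_ge0.
have hE : h ^+ 2 = 4 * Y - 27 * i%:R ^+ 2 by rewrite sqr_sqrtr // subr_ge0.
have iR : 0 <= (i%:R : R) by [].
have m1 : 1 <= (m%:R : R).
  by case: m Ym => [|m] Ym; [lra | rewrite ler1n].
have vm : 3 * i%:R / 2 + h / 2 <= (m%:R : R).
  (* The left side is at most 18 i^2 + 2 h^2 <= 8 Y < 4 m <= 4 m^2. *)
  have : (3 * i%:R + h) ^+ 2 <= (2 * m%:R) ^+ 2.
    have h1 := sqr_ge0 (3 * i%:R - h); have h2 := sqr_ge0 (i%:R : R).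
    have h3 : (m%:R : R) <= m%:R ^+ 2 by rewrite expr2 ler_peMr.
    have -> : (3 * i%:R + h) ^+ 2 = 18 * i%:R ^+ 2 + 2 * h ^+ 2 - (3 * i%:R - h) ^+ 2 by ring.
    by rewrite hE exprMn; lra.
  by rewrite ler_sqr ?nnegrE; lra.
have := @count_itv_nat (3 * i%:R / 2) (3 * i%:R / 2 + h / 2) m ltac:(lra) ltac:(lra) vm.
rewrite [3 * i%:R / 2 + h / 2]addrC addrK => H.
rewrite (eq_bigr (fun j : nat => (3 * i%:R / 2 <= (j%:R : R) < h / 2 + 3 * i%:R / 2)%R%:R)) //.
move=> j _; congr (_%:R); rewrite /c3_reduced i0 /= -(ler_nat R) !natrM; congr nat_of_bool.
have [ij|ji] := lerP (3 * i%:R) (2 * j%:R : R).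
  have -> : 3 * i%:R / 2 <= (j%:R : R) by lra.
  apply/idP/idP => H1.
    have : (2 * j%:R - 3 * i%:R) ^+ 2 < h ^+ 2 by have := c3_qformE i j; lra.
    by rewrite ltr_sqr ?nnegrE; lra.
  have : (2 * j%:R - 3 * i%:R) ^+ 2 < h ^+ 2 by rewrite ltr_sqr ?nnegrE; lra.
  by have := c3_qformE i j; lra.
by rewrite (_ : (_ <= _) = false) //; apply/negbTE; rewrite -ltNge; lra.
Qed.

(** Row lengths are 3 sqrt 3 / 2 times the heights of the quarter disc of radius r = sqrt (4 Y /
    27). The rows cost at most 1 each, in total r <= sqrt Y, and the Riemann sum costs (3 sqrt 3 /
    2) r = sqrt Y. *)
Lemma sum_c3_reduced (Y : R) (m : nat) : 0 < Y -> 2 * Y < m%:R ->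
  `|\sum_(0 <= i < m) \sum_(0 <= j < m) (c3_reduced Y i j)%:R
     - pi / (6 * Num.sqrt 3) * Y| <= 2 * Num.sqrt Y.
Proof.
move=> Y0 Ym; set y := Num.sqrt Y.
have y0 : 0 < y by rewrite sqrtr_gt0.
have yE : y ^+ 2 = Y by rewrite sqr_sqrtr // ltW.
set t := Num.sqrt (3 : R).
have t0 : 0 < t by rewrite sqrtr_gt0.
have tE : t ^+ 2 = 3 by rewrite sqr_sqrtr.
pose r := 2 * y / (3 * t).
have r0 : 0 < r by rewrite divr_gt0 ?mulr_gt0.
have rE : r ^+ 2 = 4 * Y / 27.
  by rewrite /r expr_div_n !exprMn yE tE; field.
have ry : r <= y.
  rewrite /r ler_pdivrMr ?mulr_gt0 //; have : 1 <= t by rewrite -(ler_sqr) ?nnegrE ?tE ?expr1n; lra.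
  nra.
have := quarter_disc_sum r0; set n := Num.truncn r; set G := \sum_(1 <= i < n.+1) _ => /andP[G1 G2].
have nr : n%:R <= r by rewrite truncn_le ltW.
have rn : r < n.+1%:R by have /andP[] := truncn_itv (ltW r0).
have nm : (n < m)%N.
  rewrite -(ltr_nat R); apply: le_lt_trans Ym.
  case: (n) nr => [|k] kr; first by rewrite mulr_ge0 // ltW.
  have : 1 <= (k.+1%:R : R) by rewrite ler1n.
  nra.
pose c i : R := \sum_(0 <= j < m) (c3_reduced Y i j)%:R.
have big0 i : (n < i)%N -> c i = 0.
  move=> ni; apply: big1 => j _; rewrite /c3_reduced.
  suff : ~~ (c3_qform i j < Y) by move=> /negPf ->; rewrite !andbF.
  rewrite -leNgt; have := c3_qformE i j.
  have : r ^+ 2 <= i%:R ^+ 2.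
    rewrite ler_sqr ?nnegrE ?(ltW r0) //; apply/ltW/(lt_le_trans rn).
    by rewrite ler_nat.
  have := sqr_ge0 (2 * j%:R - 3 * i%:R : R); lra.
have c0 : c 0%N = 0 by apply: big1 => j _.
rewrite -/(\sum_(0 <= i < m) c i).
have -> : \sum_(0 <= i < m) c i = \sum_(1 <= i < n.+1) c i.
  rewrite big_ltn ?(leq_ltn_trans _ nm) // c0 add0r (big_cat_nat (n := n.+1)) //=.
  by rewrite [X in _ + X]big_nat [X in _ + X]big1 ?addr0 // => i /andP[ni _]; exact: big0.
have H : `|\sum_(1 <= i < n.+1) c i - \sum_(1 <= i < n.+1) 3 * t / 2 * Num.sqrt (r ^+ 2 - i%:R ^+ 2)| <= n%:R.
  rewrite -sumrB; apply: le_trans (ler_norm_sum _ _ _) _.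
  have -> : n%:R = \sum_(1 <= i < n.+1) (1 : R) by rewrite big_const_nat iter_addr_0 subSS subn0.
  rewrite big_nat [leRHS]big_nat; apply: ler_sum => i /andP[i0 ni].
  have ir : i%:R ^+ 2 <= r ^+ 2.
    rewrite ler_sqr ?nnegrE ?(ltW r0) //; apply: le_trans nr.
    by rewrite ler_nat.
  have -> : 3 * t / 2 * Num.sqrt (r ^+ 2 - i%:R ^+ 2) = Num.sqrt (4 * Y - 27 * i%:R ^+ 2) / 2.
    have -> : 4 * Y - 27 * i%:R ^+ 2 = (3 * t) ^+ 2 * (r ^+ 2 - i%:R ^+ 2).
      by rewrite exprMn tE rE; field.
    rewrite sqrtrM ?sqr_ge0 // sqrtr_sqr gtr0_norm ?mulr_gt0 //; ring.
  by apply: sum_c3_reduced_row => //; lra.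
rewrite -mulr_sumr -/G in H.
have E1 : 3 * t / 2 * (pi / 4 * r ^+ 2) = pi / (6 * t) * Y.
  have -> : pi / (6 * t) * Y = pi * t * Y / (6 * t ^+ 2) by field; rewrite gt_eqF.
  by rewrite tE rE; field.
have E2 : 3 * t / 2 * r = y by rewrite /r; field; rewrite gt_eqF.
have k0 : 0 < 3 * t / 2 by lra.
rewrite -(ler_pM2l k0) mulrBr E1 E2 in G1; rewrite -(ler_pM2l k0) E1 in G2.
move: H; rewrite !ler_norml => /andP[H1 H2]; apply/andP; split; lra.
Qed.

End Counting.

(** * Counting pairs whose ring is not a domain *)

Lemma c3_param_le (k z w : int) : 1 <= k -> 1 <= z -> 1 <= w ->
  [/\ k <= k ^+ 2 * (z * w) ^+ 3, z <= k ^+ 2 * (z * w) ^+ 3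
    & w <= k ^+ 2 * (z * w) ^+ 3].
Proof.
move=> k1 z1 w1.
have zw1 : 1 <= z * w by exact: mulr_ege1.
have zw3 : z * w <= (z * w) ^+ 3 by rewrite ler_eXnr.
have k2 : k <= k ^+ 2 by rewrite ler_eXnr.
have C1 : 1 <= (z * w) ^+ 3 by exact: le_trans zw3.
have CC : (z * w) ^+ 3 <= k ^+ 2 * (z * w) ^+ 3.
  by rewrite ler_peMl ?(le_trans _ C1) // (le_trans k1).
split.
- by apply: le_trans k2 _; rewrite ler_peMr // sqr_ge0.
- by apply: le_trans CC; apply: le_trans zw3; rewrite ler_peMr // (le_trans _ z1).
- by apply: le_trans CC; apply: le_trans zw3; rewrite ler_peMl // (le_trans _ w1).
Qed.

Section Reducible.
Variable R : realType.

(** The parametrisation as a map of finite types, with the signs of z and w as booleans. It serves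
    to cover a set of pairs by an image; for those pairs the values are at most n, so [inord] does
    not fall back to 0. *)
Definition c3_param (n : nat) (t : 'I_n.+1 * 'I_n.+1 * 'I_n.+1 * (bool * bool)) :
    'I_n.+1 * 'I_n.+1 :=
  let z : int := (-1) ^+ t.2.1 * (t.1.1.1 : nat)%:Z in
  let w : int := (-1) ^+ t.2.2 * (t.1.1.2 : nat)%:Z in
  let k : int := (t.1.2 : nat)%:Z in
  (inord `|k * (z * w * (z - w))|, inord `|k * (z ^+ 3 - 3 * z * w ^+ 2 + w ^+ 3)|).

Definition c3_param_dom (Y : R) (z w k : nat) : bool :=
  [&& (0 < k)%N, (0 < z)%N, (0 < w)%N & k%:R ^+ 2 * (z%:R * w%:R) ^+ 3 < Y].

(** For fixed z and w the condition reads 0 < k < sqrt Y (z w)^(-3/2). The sum of these bounds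
    factors, each factor being at most 3. *)
Lemma sum_c3_param_dom (Y : R) (n : nat) : 0 < Y ->
  \sum_(0 <= z < n) \sum_(0 <= w < n) \sum_(0 <= k < n) (c3_param_dom Y z w k)%:R
    <= 9 * Num.sqrt Y.
Proof.
move=> Y0; set y := Num.sqrt Y.
have y0 : 0 < y by rewrite sqrtr_gt0.
have yE : y ^+ 2 = Y by rewrite sqr_sqrtr // ltW.
have I0 := @inv32_ge0 R.
apply: (@le_trans _ _ (\sum_(0 <= z < n) \sum_(0 <= w < n) y * inv32 R z * inv32 R w)).
  apply: ler_sum => z _; apply: ler_sum => w _.
  case: z => [|z]; first by rewrite big1 ?mulr_ge0 ?(ltW y0) // => k _; rewrite /c3_param_dom andbF.
  case: w => [|w]; first by rewrite big1 ?mulr_ge0 ?(ltW y0) // => k _; rewrite /c3_param_dom !andbF.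
  apply: le_trans (@count_pos_lt_nat R (y * inv32 R z.+1 * inv32 R w.+1) n _); last first.
    by rewrite !mulr_ge0 // ltW.
  apply: ler_sum => k _; have [/and4P[k0 _ _ H]|_] := boolP (c3_param_dom Y z.+1 w.+1 k);
    last by [].
  suff -> : (k%:R < y * inv32 R z.+1 * inv32 R w.+1) = true by rewrite k0.
  rewrite /inv32; set p := Num.sqrt z.+1%:R; set q := Num.sqrt w.+1%:R.
  have p0 : 0 < p by rewrite sqrtr_gt0.
  have q0 : 0 < q by rewrite sqrtr_gt0.
  have pE : z.+1%:R = p ^+ 2 by rewrite sqr_sqrtr.
  have qE : w.+1%:R = q ^+ 2 by rewrite sqr_sqrtr.
  rewrite pE qE in H *.
  have -> : y * (p ^+ 2 * p)^-1 * (q ^+ 2 * q)^-1 = y / (p ^+ 3 * q ^+ 3).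
    by field; rewrite !gt_eqF.
  rewrite ltr_pdivlMr ?mulr_gt0 ?exprn_gt0 //.
  rewrite -ltr_sqr ?nnegrE ?mulr_ge0 ?exprn_ge0 // ?(ltW p0) ?(ltW q0) ?(ltW y0) //.
  by rewrite yE; apply: le_lt_trans H; rewrite le_eqVlt; apply/orP; left; apply/eqP; ring.
under eq_bigr do rewrite -mulr_sumr.
rewrite -mulr_suml -mulr_sumr.
have S3 := @sum_inv32 R n.
have S0 : 0 <= \sum_(0 <= i < n) inv32 R i by apply: sumr_ge0 => i _.
have -> : 9 * y = y * 3 * 3 by ring.
apply: ler_pM => //; first by rewrite mulr_ge0 // ltW.
by rewrite ler_pM2l.
Qed.

(** Four sign choices for (z, w), each with at most 9 sqrt Y triples of absolute values. *)
Lemma card_c3_reducible (Y : R) (n : nat) : 0 < Y -> Y < n.+1%:R ->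
  #|[set p : 'I_n.+1 * 'I_n.+1 | c3_reduced Y p.1 p.2
       && ~~ `[< GRing.integral_domain_axiom (c3ring (p.1 : nat) (p.2 : nat)) >]]%SET|%:R
    <= 36 * Num.sqrt Y.
Proof.
move=> Y0 Yn.
set Bad := [set p | _]%SET.
pose D := [set t : 'I_n.+1 * 'I_n.+1 * 'I_n.+1 | c3_param_dom Y t.1.1 t.1.2 t.2]%SET.
have sub : Bad \subset [set @c3_param n t | t in finset.setX D [set: bool * bool]%SET]%SET.
  apply/fintype.subsetP => -[i j]; rewrite inE /= => /andP[/and3P[i0 ij qY] /asboolPn nd].
  have iZ : Posz i != 0 by lia.
  have [k [z [w [k0 z0 w0 [aE bE] kzw]]]] := c3_not_domain_param iZ nd.
  have qE : (c3_qform R i j) = (j%:Z ^+ 2 - 3 * i%:Z * j%:Z + 9 * i%:Z ^+ 2)%:~R.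
    by rewrite /c3_qform; ring.
  have hY : (k ^+ 2 * (`|z| * `|w|) ^+ 3)%:~R < Y.
    by apply: le_lt_trans qY; rewrite qE ler_int.
  have bnd (x : int) : x <= k ^+ 2 * (`|z| * `|w|) ^+ 3 -> 0 <= x -> (`|x| < n.+1)%N.
    move=> xk x0; rewrite -(ltr_nat R); apply: lt_trans Yn; apply: le_lt_trans hY.
    by rewrite pmulrn ler_int abszE ger0_norm.
  have z1 : 1 <= `|z| by lia.
  have w1 : 1 <= `|w| by lia.
  have [kle zle wle] := c3_param_le (k0 : 1 <= k) z1 w1.
  have kn : (`|k| < n.+1)%N by apply: bnd => //; exact: ltW.
  have zn : (`| `|z|%R | < n.+1)%N by exact: bnd.
  have wn : (`| `|w|%R | < n.+1)%N by exact: bnd.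
  rewrite absz_id in zn; rewrite absz_id in wn.
  apply/imsetP; exists (inord `|z|, inord `|w|, inord `|k|, (z < 0, w < 0)).
    rewrite !inE andbT /c3_param_dom /= !inordK // !absz_gt0 z0 w0 gt_eqF //=.
    apply: le_lt_trans hY; rewrite le_eqVlt; apply/orP; left; apply/eqP.
    rewrite [in LHS](pmulrn _ `|z|%N) !(pmulrn (1 : R)) !abszE (gtr0_norm k0).
    ring.
  rewrite /c3_param /= !inordK // -!intEsign abszE gtr0_norm // -aE -bE.
  by rewrite !absz_nat !inord_val.
apply: le_trans (_ : 4 * #|D|%:R <= _).
  rewrite -natrM ler_nat; apply: leq_trans (subset_leq_card sub) _.
  by apply: leq_trans (leq_imset_card _ _) _; rewrite cardsX cardsT card_prod card_bool mulnC.
have -> : 36 * Num.sqrt Y = 4 * (9 * Num.sqrt Y) by ring.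
rewrite ler_pM2l //; apply: le_trans (sum_c3_param_dom n.+1 Y0).
rewrite card_setE big_mkord; under [leRHS]eq_bigr do rewrite big_mkord.
rewrite pair_bigA /=; under [leRHS]eq_bigr do rewrite big_mkord.
by rewrite pair_bigA.
Qed.

End Reducible.

(** * Classification and asymptotics *)

Lemma ring_isomorphic_domain (A B : comNzRingType) :
  ring_isomorphic A B -> GRing.integral_domain_axiom A -> GRing.integral_domain_axiom B.
Proof.
move=> [f fiso] domA; have [F FE] := ring_iso_rmorph fiso.
have [_ _] := fiso; rewrite -FE => -[g gK Kg] x y xy0.
have gx0 z : g z = 0 -> z = 0 by move=> gz; rewrite -(Kg z) gz rmorph0.
have /domA/orP[] : g x * g y = 0.
  by apply: (can_inj gK); rewrite rmorphM !Kg xy0 rmorph0.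
- by move=> /eqP/gx0 ->; rewrite eqxx.
- by move=> /eqP/gx0 ->; rewrite eqxx orbT.
Qed.

Section Classification.
Variables (R : realType) (X : R).
Local Notation Y := (Num.sqrt X).
Local Notation n := (Num.truncn (2 * Y)).

(** The range 2 sqrt X of the coordinates contains all reduced pairs and meets the size condition of
    [sum_c3_reduced]. *)
Definition c3_classes : {set 'I_n.+1 * 'I_n.+1} :=
  [set p : 'I_n.+1 * 'I_n.+1 | c3_reduced Y p.1 p.2
     && `[< GRing.integral_domain_axiom (c3ring (p.1 : nat) (p.2 : nat)) >]]%SET.

Lemma c3_disc_lt (A : comNzRingType) (i j : nat) (u v : A) :
  c3_basis i j u v -> ((cubic_disc A)%:~R < X) = (c3_qform R i j < Y).
Proof.
move=> H; rewrite (c3_basis_disc H).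
have -> : (((j%:Z ^+ 2 - 3 * i%:Z * j%:Z + 9 * i%:Z ^+ 2) ^+ 2)%:~R : R) = c3_qform R i j ^+ 2.
  by rewrite /c3_qform; ring.
have q0 : 0 <= c3_qform R i j.
  have := c3_qformE R i j; have := sqr_ge0 (2 * j%:R - 3 * i%:R : R).
  have := sqr_ge0 (i%:R : R); lra.
(* For X <= 0 both sides are false: the discriminant is a square and sqrt X is 0. *)
have [X0|X0] := lerP X 0.
  by rewrite ler0_sqrtr // !ltNge q0 (le_trans X0) ?sqr_ge0.
by rewrite -[in RHS](ger0_norm q0) -sqrtr_sqr ltr_sqrt.
Qed.

(** Completing the square in either variable gives 27 i^2 <= 4 Q and 3 j^2 <= 4 Q, where Q < sqrt
    X. *)
Lemma c3_reduced_bound (i j : nat) :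
  c3_reduced Y i j -> (i < n.+1)%N /\ (j < n.+1)%N.
Proof.
move=> /and3P[i0 ij qY].
have Y0 : 0 <= Y by exact: sqrtr_ge0.
have sq (k : nat) : (k%:R : R) <= k%:R ^+ 2.
  by rewrite -natrX ler_nat; case: k => // k; rewrite expnS leq_pmulr.
have E1 : 4 * c3_qform R i j = (2 * j%:R - 3 * i%:R) ^+ 2 + 27 * i%:R ^+ 2 by rewrite c3_qformE.
have E2 : 4 * c3_qform R i j = 3 * j%:R ^+ 2 + (6 * i%:R - j%:R) ^+ 2.
  by rewrite /c3_qform; ring.
have s1 := sqr_ge0 (2 * j%:R - 3 * i%:R : R); have s2 := sqr_ge0 (6 * i%:R - j%:R : R).
have si := sq i; have sj := sq j; have i1 : 0 <= (i%:R : R) by [].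
by rewrite !ltnS !truncn_ge_nat ?mulr_ge0 //; split; lra.
Qed.

(** [c3ring_iso_reduced] makes the representatives pairwise non-isomorphic, and
    [C3_order_reduced_basis] shows that they exhaust the classes. *)
Lemma c3_classesP :
  num_iso_classes (fun A => C3_cubic_order A /\ (cubic_disc A)%:~R < X) #|c3_classes|.
Proof.
pose S (i : 'I_#|c3_classes|) : comNzRingType :=
  c3ring ((enum_val i).1 : nat) ((enum_val i).2 : nat).
have SP (i : 'I_#|c3_classes|) : c3_reduced Y (enum_val i).1 (enum_val i).2 /\ GRing.integral_domain_axiom (S i).
  by have := enum_valP i; rewrite inE => /andP[H /asboolP].
exists S; split.
- move=> i; have [/and3P[_ _ qY] dom] := SP i; split; first exact: c3ring_C3_order.
  by rewrite (c3_disc_lt (c3ring_basis _ _)).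
- move=> i j Sij; have [/and3P[i0 ij _] domi] := SP i; have [/and3P[j0 jj _] domj] := SP j.
  have := c3ring_iso_reduced domj _ _ _ _ Sij.
  move=> /(_ ltac:(lia) ltac:(lia) ltac:(lia) ltac:(lia)) [[e1] [e2]].
  apply: enum_val_inj; rewrite [LHS]surjective_pairing [RHS]surjective_pairing.
  by congr pair; apply: val_inj.
- move=> A [A3 Ad]; have [a [b [u [v [H a0 ab]]]]] := C3_order_reduced_basis A3.
  case: a H a0 ab => // i H i0; case: b H => [j|j] H ij; last by lia.
  rewrite (c3_disc_lt H) in Ad.
  have red : c3_reduced Y i j by apply/and3P; split=> //; lia.
  have [iB jB] := c3_reduced_bound red.
  have Aiso := c3_basis_iso H.
  have inC : (Ordinal iB, Ordinal jB) \in c3_classes.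
    rewrite inE /= red; apply/asboolP; apply: ring_isomorphic_domain Aiso _.
    by case: A3 => -[].
  by exists (enum_rank_in inC (Ordinal iB, Ordinal jB)); rewrite /S enum_rankK_in.
Qed.

(** Here 38 = 2 + 36, from the lattice count and from the discarded non-domains. *)
Lemma card_c3_classes : 0 < X ->
  `|#|c3_classes|%:R - pi / (6 * Num.sqrt 3) * Y| <= 38 * Num.sqrt Y.
Proof.
move=> X0; have Y0 : 0 < Y by rewrite sqrtr_gt0.
have Yn : 2 * Y < n.+1%:R.
  by have /andP[] := truncn_itv (mulr_ge0 (ler0n R 2) (ltW Y0)).
have H1 := sum_c3_reduced Y0 Yn.
have H2 := @card_c3_reducible R Y n Y0 ltac:(lra).
set Bad := finset _ in H2.
have E : \sum_(0 <= i < n.+1) \sum_(0 <= j < n.+1) (c3_reduced Y i j)%:R =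
    #|c3_classes|%:R + #|Bad|%:R :> R.
  rewrite !card_setE -big_split /= big_mkord.
  under [LHS]eq_bigr do rewrite big_mkord.
  rewrite pair_bigA /=; apply: eq_bigr => p _.
  by rewrite -natrD; case: (c3_reduced _ _ _) => //=; case: (asbool _).
rewrite E in H1; have := ler0n R #|Bad|.
have s0 := sqrtr_ge0 Y.
move: H1; rewrite !ler_norml => /andP[h1 h2] h3; apply/andP; split; lra.
Qed.

End Classification.

Theorem theorem1 (R : realType) :
  exists N : R -> nat,
    (forall X : R,
       num_iso_classes
         (fun A => C3_cubic_order A /\ (cubic_disc A)%:~R < X) (N X)) /\
    (fun X : R => (N X)%:R : R)
      = (fun X : R => pi / (6 * Num.sqrt 3) * X `^ (1 / 2))
        +O_ (pinfty_nbhs R) (fun X : R => X `^ (1 / 4)).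
Proof.
exists (fun X => #|c3_classes X|); split; first exact: c3_classesP.
apply/eqaddOP/bigO_exP; exists 38 => //.
near=> X.
have X0 : 0 < X by near: X; exact: nbhs_pinfty_gt.
have E2 : X `^ (1 / 2) = Num.sqrt X by rewrite div1r powR12_sqrt // ltW.
have -> : X `^ (1 / 4) = Num.sqrt (Num.sqrt X).
  rewrite (_ : 1 / 4 = (1 / 2) * 2^-1); last by field.
  by rewrite powRrM E2 powR12_sqrt // sqrtr_ge0.
rewrite -[leLHS]/(`|#|c3_classes X|%:R - pi / (6 * Num.sqrt 3) * X `^ (1 / 2)|) E2.
by rewrite [`|Num.sqrt (Num.sqrt X)|]ger0_norm ?sqrtr_ge0 // card_c3_classes.
Unshelve. all: by end_near. Qed.
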